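(* Let $\mathbb{H}_1$ and $\mathbb{H}_2$ be localic $\mathcal{S}$-fibered categories, and let $R: \mathbb{H}_1 \to \mathbb{H}_2$ be a localic morphism between the underlying localic $\mathcal{U}$-fibered categories. Then there exists a morphism of triangulated $\mathcal{S}$-fibered categories $\tilde{R}: \mathbb{H}_1 \to \mathbb{H}_2$ whose restriction to $\mathcal{U}$ coincides with $R$, and it is unique up to unique $2$-isomorphism (restricting to the identity of $R$ over $\mathcal{U}$). Moreover, the morphism $\tilde{R}$ is automatically localic.
   Context: Base category. $\mathcal{S}$ is a fixed small category with finite products and final object $\ast$, equipped with two (possibly non-full) subcategories $\mathcal{S}^{sm}$ (its morphisms are called smooth morphisms) and $\mathcal{S}^{cl}$ (its morphisms are called closed immersions) such that: (i) both have the same objects as $\mathcal{S}$ and contain all isomorphisms of $\mathcal{S}$; (ii) for every smooth $p: P \to S$ and every $f: T \to S$ in $\mathcal{S}$ the fibered product $P\times_S T$ exists in $\mathcal{S}$ and its projection to $T$ is smooth; (iii) for every smooth $p: P\to S$ and closed immersion $z: Z\to S$ the projection $P\times_S Z\to P$ is a closed immersion, and whenever $z: Z\to S$, $g: S\to V$ are morphisms of $\mathcal{S}$ with $gz$ a closed immersion, $z$ is a closed immersion; (iv) every $f: T\to S$ in $\mathcal{S}$ factors as $f=p\circ t$ with $t: T\to P$ a closed immersion and $p: P\to S$ smooth. $\mathcal{U}$ is the full subcategory of $\mathcal{S}$ of all $Y$ such that $Y\to\ast$ is smooth; its smooth morphisms and closed immersions are those of $\mathcal{S}$ lying in $\mathcal{U}$.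 Moreover: (v) $\mathcal{S}$ has an initial object $\emptyset$; (vi) for every closed immersion $z: Z\to S$ there is a distinguished smooth morphism $u: U\to S$ (the open immersion complementary to $z$; $U$ is the open complement of $Z$ in $S$) such that for every $T\in\mathcal{S}$ composition with $u$ identifies $\mathrm{Hom}_{\mathcal{S}}(T,U)$ with the subset of those $f\in\mathrm{Hom}_{\mathcal{S}}(T,S)$ for which the square with sides $\emptyset\to T$, $f:T\to S$, $\emptyset\to Z$, $z: Z\to S$ is Cartesian; (vii) for every $S\in\mathcal{S}$ there is a finite sequence of closed immersions $\emptyset=Z_{-1}\to Z_0\to\cdots\to Z_n=S$ such that for each $r=0,\dots,n$ the open complement of $Z_{r-1}$ in $Z_r$ belongs to $\mathcal{U}$. Fibered categories. Let $\mathcal{C}$ be $\mathcal{S}$ or $\mathcal{U}$. A $\mathcal{C}$-fibered category $\mathbb{H}$ consists of a category $\mathbb{H}(S)$ for each $S\in\mathcal{C}$, a functor $f^*:\mathbb{H}(S)\to\mathbb{H}(T)$ for each $f: T\to S$ in $\mathcal{C}$, and natural isomorphisms $\mathsf{conn}_{f,g}:(gf)^*\xrightarrow{\sim} f^*g^*$ for composable $f: T\to S$, $g: S\to V$, such that $\mathrm{id}_S^*=\mathrm{id}_{\mathbb{H}(S)}$ and, for composable $f,g,h$, the two resulting isomorphisms $(hgf)^*\xrightarrow{\sim} f^*g^*h^*$ agree. Connection isomorphisms are written as equalities. An $\mathcal{S}$-fibered category restricts to a $\mathcal{U}$-fibered category, denoted by the same symbol. Localic fibered categories. A triangulated $\mathcal{C}$-fibered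 category is one where all $\mathbb{H}(S)$ are triangulated categories, all $f^*$ are triangulated functors and all connection isomorphisms are isomorphisms of triangulated functors. It is localic if: (a) $\mathbb{H}(\emptyset)=0$; (b) for every smooth $p: P\to S$ the functor $p^*$ has a left adjoint $p_\#$, and for every Cartesian square with $p: P\to S$ smooth, $f: T\to S$, $p': P_T\to T$, $f': P_T\to P$, the composite $p'_\#f'^*\xrightarrow{\eta}p'_\#f'^*p^*p_\#=p'_\#p'^*f^*p_\#\xrightarrow{\epsilon}f^*p_\#$ is invertible; (c) for every closed immersion $z: Z\to S$ the functor $z^*$ has a right adjoint $z_*$, which is fully faithful; (d) for every closed immersion $z$ with complementary open immersion $u$, the pair $(z^*,u^* )$ is conservative. Here $\eta$ and $\epsilon$ denote units and co-units of adjunctions. A localic $\mathcal{S}$-fibered category restricts to a localic $\mathcal{U}$-fibered category. Morphisms. A morphism of $\mathcal{C}$-fibered categories $R:\mathbb{H}_1\to\mathbb{H}_2$ consists of functors $R_S:\mathbb{H}_1(S)\to\mathbb{H}_2(S)$ for $S\in\mathcal{C}$ and natural isomorphisms $\theta_f: f^*R_S(A)\xrightarrow{\sim}R_T(f^*A)$ for $f: T\to S$ in $\mathcal{C}$ such that, for composable $f: T\to S$, $g: S\to V$, the isomorphism $\theta_{gf}$ equals the composite $f^*g^*R_V(A)\xrightarrow{\theta_g}f^*R_S(g^*A)\xrightarrow{\theta_f}R_T(f^*g^*A)$ (modulo connection isomorphisms). It is a morphism of triangulated $\mathcal{C}$-fibered categories (a triangulated morphism) if the $R_S$ are triangulated functors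 and the $\theta_f$ are isomorphisms of triangulated functors. A triangulated morphism between localic ones is localic if for every smooth $p: P\to S$ in $\mathcal{C}$ the composite $p_\#R_P(A)\xrightarrow{\eta}p_\#R_P(p^*p_\#A)\xrightarrow{\theta_p^{-1}}p_\#p^*R_S(p_\#A)\xrightarrow{\epsilon}R_S(p_\#A)$ is invertible. A $2$-morphism $\gamma: R\to R'$ is a family of natural transformations $\gamma_S: R_S\to R'_S$ with $\theta'_f\circ f^*\gamma_S=\gamma_T f^*\circ\theta_f$ for all $f: T\to S$; it is a $2$-isomorphism if all $\gamma_S$ are invertible. *)

(* Defs.v *)
From mathcomp Require Import ssreflect ssrfun ssrbool eqtype ssrnat.

Set Implicit Arguments.
Unset Strict Implicit.
Unset Printing Implicit Defensive.

Declare Scope cat_scope.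
Delimit Scope cat_scope with cat.
Local Open Scope cat_scope.

Record category := Category {
  ob :> Type;
  hom : ob -> ob -> Type;
  idc : forall a, hom a a;
  compose : forall a b c, hom b c -> hom a b -> hom a c;
  compose1c : forall a b (f : hom a b), compose (idc b) f = f;
  composec1 : forall a b (f : hom a b), compose f (idc a) = f;
  composeA : forall a b c d (h : hom c d) (g : hom b c) (f : hom a b),
    compose h (compose g f) = compose (compose h g) f
}.
Arguments hom {_} _ _.
Arguments idc {_} _.
Arguments compose {_ _ _ _} _ _.
Arguments composeA {_ _ _ _ _} _ _ _.

Notation "g ∘ f" := (compose g f) (at level 40, left associativity) : cat_scope.

Section CategoryNotions.
Variable C : category.

Definition is_iso (a b : C) (f : hom a b) : Prop :=
  exists g : hom b a, g ∘ f = idc a /\ f ∘ g = idc b.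

Definition cast (a b : C) (e : a = b) : hom a b :=
  match e in _ = x return hom a x with erefl => idc a end.

Definition is_zero (z : C) : Prop :=
  forall a : C, (exists! f : hom z a, True) /\ (exists! f : hom a z, True).

Definition is_product (a b s : C) (p : hom s a) (q : hom s b) : Prop :=
  forall x (f : hom x a) (g : hom x b),
    exists! k : hom x s, p ∘ k = f /\ q ∘ k = g.

(* The square

      PT --f'--> P
      |          |
      p'         p
      v          v
      T  --f-->  S
*)
Definition cartesian (P S T PT : C) (p : hom P S) (f : hom T S)
    (f' : hom PT P) (p' : hom PT T) : Prop :=
  p ∘ f' = f ∘ p' /\
  forall X (a : hom X P) (b : hom X T), p ∘ a = f ∘ b ->
    exists! k : hom X PT, f' ∘ k = a /\ p' ∘ k = b.

End CategoryNotions.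

Record functor (C D : category) := Functor {
  fob :> C -> D;
  fmap : forall a b : C, hom a b -> hom (fob a) (fob b);
  fmap1 : forall a, fmap (idc a) = idc (fob a);
  fmapM : forall a b c (g : hom b c) (f : hom a b),
    fmap (g ∘ f) = fmap g ∘ fmap f
}.
Arguments fmap {_ _} _ {_ _} _.

Definition fid (C : category) : functor C C :=
  @Functor C C (fun a => a) (fun _ _ f => f)
    (fun _ => erefl) (fun _ _ _ _ _ => erefl).

Definition fcomp (C D E : category) (G : functor D E) (F : functor C D) :
  functor C E :=
  @Functor C E (fun a => G (F a)) (fun _ _ f => fmap G (fmap F f))
    (fun a => etrans (congr1 (fmap G) (fmap1 F a)) (fmap1 G (F a)))
    (fun _ _ _ g f => etrans (congr1 (fmap G) (fmapM F g f))
                             (fmapM G (fmap F g) (fmap F f))).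

Definition fully_faithful (C D : category) (F : functor C D) : Prop :=
  forall (a b : C) (g : hom (F a) (F b)), exists! f : hom a b, fmap F f = g.

Definition ess_surjective (C D : category) (F : functor C D) : Prop :=
  forall b : D, exists (a : C) (f : hom (F a) b), is_iso f.

Record nat_trans (C D : category) (F G : functor C D) := NatTrans {
  nt :> forall a, hom (F a) (G a);
  nt_natural : forall a b (f : hom a b), nt b ∘ fmap F f = fmap G f ∘ nt a
}.

Record nat_iso (C D : category) (F G : functor C D) := NatIso {
  ni :> nat_trans F G;
  ni_inv : nat_trans G F;
  ni_invl : forall a, ni_inv a ∘ ni a = idc (F a);
  ni_invr : forall a, ni a ∘ ni_inv a = idc (G a)
}.

Definition nt_id (C D : category) (F : functor C D) : nat_trans F F :=
  @NatTrans C D F F (fun a => idc (F a))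
    (fun _ _ f => etrans (compose1c (fmap F f)) (esym (composec1 (fmap F f)))).

(* [adjunction L F]: L is left adjoint to F *)
Record adjunction (C D : category) (L : functor D C) (F : functor C D) :=
  Adjunction {
  unit_of : nat_trans (fid D) (fcomp F L);
  counit_of : nat_trans (fcomp L F) (fid C);
  triangleL : forall b : D,
    counit_of (L b) ∘ fmap L (unit_of b) = idc (L b);
  triangleR : forall a : C,
    fmap F (counit_of a) ∘ unit_of (F a) = idc (F a)
}.

Definition full_sub (C : category) (Q : C -> Prop) : category :=
  @Category {X : C | Q X} (fun X Y => hom (sval X) (sval Y))
    (fun X => idc (sval X)) (fun _ _ _ g f => g ∘ f)
    (fun _ _ f => compose1c f) (fun _ _ f => composec1 f)
    (fun _ _ _ _ h g f => composeA h g f).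

Record additive (C : category) := Additive {
  zeroh : forall a b : C, hom a b;
  opph : forall a b : C, hom a b -> hom a b;
  addh : forall a b : C, hom a b -> hom a b -> hom a b;
  addhA : forall a b (f g h : hom a b), addh f (addh g h) = addh (addh f g) h;
  addhC : forall a b (f g : hom a b), addh f g = addh g f;
  add0h : forall a b (f : hom a b), addh (zeroh a b) f = f;
  addNh : forall a b (f : hom a b), addh (opph f) f = zeroh a b;
  compDl : forall a b c (g h : hom b c) (f : hom a b),
    addh g h ∘ f = addh (g ∘ f) (h ∘ f);
  compDr : forall a b c (h : hom b c) (f g : hom a b),
    h ∘ addh f g = addh (h ∘ f) (h ∘ g);
  has_zero : exists z : C, is_zero z;
  has_products : forall a b : C,
    exists (s : C) (p : hom s a) (q : hom s b), is_product p q
}.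

Definition additive_functor (C D : category) (aC : additive C) (aD : additive D)
    (F : functor C D) : Prop :=
  forall (a b : C) (f g : hom a b),
    fmap F (addh aC f g) = addh aD (fmap F f) (fmap F g).

(* [dist f g h]: the triangle X -f-> Y -g-> Z -h-> X[1] is distinguished.  The
   shift is only required to be an additive self-equivalence. *)
Record triangulated (C : category) := Triangulated {
  tadd :> additive C;
  shift : functor C C;
  shift_additive : additive_functor tadd tadd shift;
  shift_ff : fully_faithful shift;
  shift_es : ess_surjective shift;
  dist : forall X Y Z : C, hom X Y -> hom Y Z -> hom Z (shift X) -> Prop;
  TR1_iso : forall (X Y Z X' Y' Z' : C)
      (f : hom X Y) (g : hom Y Z) (h : hom Z (shift X))
      (f' : hom X' Y') (g' : hom Y' Z') (h' : hom Z' (shift X'))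
      (i : hom X X') (j : hom Y Y') (k : hom Z Z'),
    is_iso i -> is_iso j -> is_iso k ->
    j ∘ f = f' ∘ i -> k ∘ g = g' ∘ j -> fmap shift i ∘ h = h' ∘ k ->
    dist f g h -> dist f' g' h';
  TR1_id : forall X Z : C, is_zero Z ->
    dist (idc X) (zeroh tadd X Z) (zeroh tadd Z (shift X));
  TR1_cone : forall (X Y : C) (f : hom X Y),
    exists (Z : C) (g : hom Y Z) (h : hom Z (shift X)), dist f g h;
  TR2 : forall (X Y Z : C) (f : hom X Y) (g : hom Y Z) (h : hom Z (shift X)),
    dist f g h <-> dist g h (opph tadd (fmap shift f));
  TR3 : forall (X Y Z X' Y' Z' : C)
      (f : hom X Y) (g : hom Y Z) (h : hom Z (shift X))
      (f' : hom X' Y') (g' : hom Y' Z') (h' : hom Z' (shift X'))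
      (i : hom X X') (j : hom Y Y'),
    dist f g h -> dist f' g' h' -> j ∘ f = f' ∘ i ->
    exists k : hom Z Z', k ∘ g = g' ∘ j /\ fmap shift i ∘ h = h' ∘ k;
  TR4 : forall (X Y Z X' Y' Z' : C) (f : hom X Y) (g : hom Y Z)
      (a : hom Y Z') (a' : hom Z' (shift X))
      (b : hom Z X') (b' : hom X' (shift Y))
      (c : hom Z Y') (c' : hom Y' (shift X)),
    dist f a a' -> dist g b b' -> dist (g ∘ f) c c' ->
    exists (u : hom Z' Y') (v : hom Y' X'),
      [/\ dist u v (fmap shift a ∘ b'),
          u ∘ a = c ∘ g, c' ∘ u = a',
          v ∘ c = b & b' ∘ v = fmap shift f ∘ c']
}.
Arguments shift {_} _.

Record tri_functor (C D : category) (tC : triangulated C) (tD : triangulated D)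
    (F : functor C D) := TriFunctor {
  tf_shift : nat_iso (fcomp F (shift tC)) (fcomp (shift tD) F);
  tf_additive : additive_functor tC tD F;
  tf_dist : forall (X Y Z : C)
      (f : hom X Y) (g : hom Y Z) (h : hom Z (shift tC X)),
    dist f g h -> dist (fmap F f) (fmap F g) (tf_shift X ∘ fmap F h)
}.

(* the commutation with shifts F (A[1]) -> F(A)[1], as a bare family *)
Definition shift_comm (C D : category) (tC : triangulated C)
    (tD : triangulated D) (F : functor C D) : Type :=
  forall A : C, hom (F (shift tC A)) (shift tD (F A)).

Definition shift_comm_of (C D : category) (tC : triangulated C)
    (tD : triangulated D) (F : functor C D) (tF : tri_functor tC tD F) :
  shift_comm tC tD F := fun A => tf_shift tF A.

Definition shift_comm_comp (C D E : category) (tC : triangulated C)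
    (tD : triangulated D) (tE : triangulated E)
    (G : functor D E) (F : functor C D)
    (tG : tri_functor tD tE G) (tF : tri_functor tC tD F) :
  shift_comm tC tE (fcomp G F) :=
  fun A => tf_shift tG (F A) ∘ fmap G (tf_shift tF A).

Definition triangulated_trans (C D : category) (tC : triangulated C)
    (tD : triangulated D) (F G : functor C D)
    (cF : shift_comm tC tD F) (cG : shift_comm tC tD G)
    (alpha : nat_trans F G) : Prop :=
  forall A : C, cG A ∘ alpha (shift tC A) = fmap (shift tD) (alpha A) ∘ cF A.

Record fibered (C : category) := Fibered {
  fib :> C -> category;
  pull : forall T S : C, hom T S -> functor (fib S) (fib T);
  conn : forall (T S V : C) (f : hom T S) (g : hom S V),
    nat_iso (pull (g ∘ f)) (fcomp (pull f) (pull g));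
  pull_id : forall S : C, pull (idc S) = fid (fib S);
  conn_cocycle : forall (T S V W : C)
      (f : hom T S) (g : hom S V) (h : hom V W) (A : fib W),
    fmap (pull f) (conn g h A) ∘ conn f (h ∘ g) A
    = conn f g (pull h A) ∘ conn (g ∘ f) h A
      ∘ cast (congr1 (fun k => pull k A) (esym (composeA h g f)))
}.
Arguments pull {_} _ {_ _} _.
Arguments conn {_} _ {_ _ _} _ _.

(* Each [pull f] is triangulated and each [conn f g] is an isomorphism of
   triangulated functors; [pull_id] remains an equality of plain functors. *)
Record tri_fibered (C : category) := TriFibered {
  tfib :> fibered C;
  tri : forall S : C, triangulated (tfib S);
  tri_pull : forall (T S : C) (f : hom T S),
    tri_functor (tri S) (tri T) (pull tfib f);
  tri_conn : forall (T S V : C) (f : hom T S) (g : hom S V),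
    triangulated_trans (shift_comm_of (tri_pull (g ∘ f)))
      (shift_comm_comp (tri_pull f) (tri_pull g)) (conn tfib f g)
}.
Arguments tri {_} _ _.
Arguments tri_pull {_} _ {_ _} _.

Record fib_mor (C : category) (H1 H2 : fibered C) := FibMor {
  mor :> forall S : C, functor (H1 S) (H2 S);
  theta : forall (T S : C) (f : hom T S),
    nat_iso (fcomp (pull H2 f) (mor S)) (fcomp (mor T) (pull H1 f));
  theta_cocycle : forall (T S V : C) (f : hom T S) (g : hom S V) (A : H1 V),
    fmap (mor T) (conn H1 f g A) ∘ theta (g ∘ f) A
    = theta f (pull H1 g A) ∘ fmap (pull H2 f) (theta g A)
      ∘ conn H2 f g (mor V A)
}.
Arguments theta {_ _ _} _ {_ _} _.

Record tri_mor (C : category) (H1 H2 : tri_fibered C) := TriMor {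
  tmor :> fib_mor H1 H2;
  tri_mor_at : forall S : C, tri_functor (tri H1 S) (tri H2 S) (tmor S);
  tri_theta : forall (T S : C) (f : hom T S),
    triangulated_trans (shift_comm_comp (tri_pull H2 f) (tri_mor_at S))
      (shift_comm_comp (tri_mor_at T) (tri_pull H1 f)) (theta tmor f)
}.

Record mor2 (C : category) (H1 H2 : fibered C) (R R' : fib_mor H1 H2) := Mor2 {
  m2 :> forall S : C, nat_trans (R S) (R' S);
  m2_theta : forall (T S : C) (f : hom T S) (A : H1 S),
    theta R' f A ∘ fmap (pull H2 f) (m2 S A)
    = m2 T (pull H1 f A) ∘ theta R f A
}.

Definition is_2iso (C : category) (H1 H2 : fibered C) (R R' : fib_mor H1 H2)
    (gamma : mor2 R R') : Prop :=
  forall (S : C) (A : H1 S), is_iso (gamma S A).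

Lemma mor2_id_theta (C : category) (H1 H2 : fibered C) (R : fib_mor H1 H2)
    (T S : C) (f : hom T S) (A : H1 S) :
  theta R f A ∘ fmap (pull H2 f) (nt_id (R S) A)
  = nt_id (R T) (pull H1 f A) ∘ theta R f A.
Proof. by rewrite /= fmap1 composec1 compose1c. Qed.

Definition mor2_id (C : category) (H1 H2 : fibered C) (R : fib_mor H1 H2) :
  mor2 R R := Mor2 (m2 := fun S => nt_id (R S)) (@mor2_id_theta C H1 H2 R).

Definition mor2_of_eq (C : category) (H1 H2 : tri_fibered C)
    (R R' : tri_mor H1 H2) (e : R = R') : mor2 R R' :=
  match e in _ = X return mor2 R X with erefl => mor2_id R end.

Section Restriction.
Variables (C : category) (Q : C -> Prop).

Definition restr_fib (H : fibered C) : fibered (full_sub Q) :=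
  @Fibered (full_sub Q) (fun X => H (sval X))
    (fun T S f => @pull C H (sval T) (sval S) f)
    (fun T S V f g => @conn C H (sval T) (sval S) (sval V) f g)
    (fun S => pull_id H (sval S))
    (fun T S V W f g h A =>
       @conn_cocycle C H (sval T) (sval S) (sval V) (sval W) f g h A).

Definition restr_tri (H : tri_fibered C) : tri_fibered (full_sub Q) :=
  @TriFibered (full_sub Q) (restr_fib H) (fun X => tri H (sval X))
    (fun T S f => @tri_pull C H (sval T) (sval S) f)
    (fun T S V f g => @tri_conn C H (sval T) (sval S) (sval V) f g).

Definition restr_fib_mor (H1 H2 : fibered C) (R : fib_mor H1 H2) :
  fib_mor (restr_fib H1) (restr_fib H2) :=
  @FibMor (full_sub Q) (restr_fib H1) (restr_fib H2) (fun X => R (sval X))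
    (fun T S f => @theta C H1 H2 R (sval T) (sval S) f)
    (fun T S V f g A =>
       @theta_cocycle C H1 H2 R (sval T) (sval S) (sval V) f g A).

Definition restr_mor (H1 H2 : tri_fibered C) (R : tri_mor H1 H2) :
  tri_mor (restr_tri H1) (restr_tri H2) :=
  @TriMor (full_sub Q) (restr_tri H1) (restr_tri H2) (restr_fib_mor R)
    (fun X => tri_mor_at R (sval X))
    (fun T S f => @tri_theta C H1 H2 R (sval T) (sval S) f).

Definition restr_mor2 (H1 H2 : fibered C) (R R' : fib_mor H1 H2)
    (gamma : mor2 R R') : mor2 (restr_fib_mor R) (restr_fib_mor R') :=
  @Mor2 (full_sub Q) (restr_fib H1) (restr_fib H2)
    (restr_fib_mor R) (restr_fib_mor R') (fun X => gamma (sval X))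
    (fun T S f A => @m2_theta C H1 H2 R R' gamma (sval T) (sval S) f A).

End Restriction.

Record base := Base {
  bcat :> category;
  pt : bcat;
  to_pt : forall X : bcat, hom X pt;
  to_pt_uniq : forall (X : bcat) (f : hom X pt), f = to_pt X;
  base_prods : forall X Y : bcat,
    exists (s : bcat) (p : hom s X) (q : hom s Y), is_product p q;
  smooth : forall X Y : bcat, hom X Y -> Prop;
  closed : forall X Y : bcat, hom X Y -> Prop;
  smooth_iso : forall (X Y : bcat) (f : hom X Y), is_iso f -> smooth f;
  smooth_comp : forall (X Y Z : bcat) (g : hom Y Z) (f : hom X Y),
    smooth g -> smooth f -> smooth (g ∘ f);
  closed_iso : forall (X Y : bcat) (f : hom X Y), is_iso f -> closed f;
  closed_comp : forall (X Y Z : bcat) (g : hom Y Z) (f : hom X Y),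
    closed g -> closed f -> closed (g ∘ f);
  smooth_pullback_ex : forall (P S T : bcat) (p : hom P S) (f : hom T S),
    smooth p ->
    exists (PT : bcat) (f' : hom PT P) (p' : hom PT T), cartesian p f f' p';
  smooth_pullback : forall (P S T PT : bcat) (p : hom P S) (f : hom T S)
      (f' : hom PT P) (p' : hom PT T),
    smooth p -> cartesian p f f' p' -> smooth p';
  closed_pullback : forall (P S Z PZ : bcat) (p : hom P S) (z : hom Z S)
      (z' : hom PZ P) (p' : hom PZ Z),
    smooth p -> closed z -> cartesian p z z' p' -> closed z';
  closed_cancel : forall (Z S V : bcat) (z : hom Z S) (g : hom S V),
    closed (g ∘ z) -> closed z;
  factorization : forall (T S : bcat) (f : hom T S),
    exists (P : bcat) (t : hom T P) (p : hom P S),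
      [/\ closed t, smooth p & f = p ∘ t];
  empty : bcat;
  from_empty : forall X : bcat, hom empty X;
  from_empty_uniq : forall (X : bcat) (f : hom empty X), f = from_empty X;
  compl : forall (Z S : bcat) (z : hom Z S), closed z -> bcat;
  compl_mor : forall (Z S : bcat) (z : hom Z S) (hz : closed z),
    hom (compl hz) S;
  compl_smooth : forall (Z S : bcat) (z : hom Z S) (hz : closed z),
    smooth (compl_mor hz);
  compl_inj : forall (Z S : bcat) (z : hom Z S) (hz : closed z) (T : bcat)
      (g h : hom T (compl hz)),
    compl_mor hz ∘ g = compl_mor hz ∘ h -> g = h;
  compl_image : forall (Z S : bcat) (z : hom Z S) (hz : closed z) (T : bcat)
      (f : hom T S),
    (exists g : hom T (compl hz), f = compl_mor hz ∘ g) <->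
    cartesian f z (from_empty T) (from_empty Z);
  (* indices are shifted by one: [Zs r] is the stratum numbered r - 1, and only
     the part [Zs 0 -> ... -> Zs n.+1] of the sequence is used *)
  stratification : forall S : bcat,
    exists (n : nat) (Zs : nat -> bcat) (z : forall r, hom (Zs r) (Zs r.+1)),
      [/\ Zs 0 = empty, Zs n.+1 = S &
          forall r, r <= n ->
            exists hz : closed (z r), smooth (to_pt (compl hz))]
}.
Arguments smooth {_ _ _} _.
Arguments closed {_ _ _} _.
Arguments to_pt {_} _.
Arguments empty {_}.
Arguments compl_mor {_ _ _ _} _.

Definition inU (B : base) (Y : B) : Prop := smooth (to_pt Y).

Definition U (B : base) : category := full_sub (@inU B).

Definition smoothU (B : base) (X Y : U B) (f : hom X Y) : Prop :=
  @smooth B (sval X) (sval Y) f.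

(* Stated for arbitrary adjunctions; adjoints being unique up to a unique
   isomorphism, invertibility does not depend on them.
   p'_# f'^* -> p'_# f'^* p^* p_# = p'_# p'^* f^* p_# -> f^* p_#,
   where L is p_# and L' is p'_# *)
Definition exchange (C : category) (H : fibered C) (P S T PT : C)
    (p : hom P S) (f : hom T S) (f' : hom PT P) (p' : hom PT T)
    (e : p ∘ f' = f ∘ p')
    (L : functor (H P) (H S)) (adj : adjunction L (pull H p))
    (L' : functor (H PT) (H T)) (adj' : adjunction L' (pull H p'))
    (A : H P) : hom (L' (pull H f' A)) (pull H f (L A)) :=
  counit_of adj' (pull H f (L A))
  ∘ (fmap L' (conn H p' f (L A)
              ∘ cast (congr1 (fun k => pull H k (L A)) e)
              ∘ ni_inv (conn H f' p) (L A))
  ∘ fmap L' (fmap (pull H f') (unit_of adj A))).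

Record localic (B : base) (H : tri_fibered B) : Prop := Localic {
  localic_empty : forall A : H empty, is_zero A;
  localic_left_adj : forall (P S : B) (p : hom P S), smooth p ->
    exists L : functor (H P) (H S), inhabited (adjunction L (pull H p));
  localic_base_change : forall (P S T PT : B) (p : hom P S) (f : hom T S)
      (f' : hom PT P) (p' : hom PT T)
      (L : functor (H P) (H S)) (adj : adjunction L (pull H p))
      (L' : functor (H PT) (H T)) (adj' : adjunction L' (pull H p'))
      (cart : cartesian p f f' p') (A : H P),
    smooth p -> is_iso (exchange (proj1 cart) adj adj' A);
  localic_right_adj : forall (Z S : B) (z : hom Z S), closed z ->
    exists zs : functor (H Z) (H S),
      inhabited (adjunction (pull H z) zs) /\ fully_faithful zs;
  localic_conservative : forall (Z S : B) (z : hom Z S) (hz : closed z)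
      (X Y : H S) (a : hom X Y),
    is_iso (fmap (pull H z) a) -> is_iso (fmap (pull H (compl_mor hz)) a) ->
    is_iso a
}.

(* p_# R_P -> p_# R_P p^* p_# -> p_# p^* R_S p_# -> R_S p_#,
   where L1 and L2 are p_# for H1 and H2 *)
Definition sharp_comparison (C : category) (H1 H2 : fibered C)
    (R : fib_mor H1 H2) (P S : C) (p : hom P S)
    (L1 : functor (H1 P) (H1 S)) (adj1 : adjunction L1 (pull H1 p))
    (L2 : functor (H2 P) (H2 S)) (adj2 : adjunction L2 (pull H2 p))
    (A : H1 P) : hom (L2 (R P A)) (R S (L1 A)) :=
  counit_of adj2 (R S (L1 A))
  ∘ (fmap L2 (ni_inv (theta R p) (L1 A))
  ∘ fmap L2 (fmap (R P) (unit_of adj1 A))).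

Definition localic_mor (C : category)
    (sm : forall X Y : C, hom X Y -> Prop)
    (H1 H2 : tri_fibered C) (R : tri_mor H1 H2) : Prop :=
  forall (P S : C) (p : hom P S)
    (L1 : functor (H1 P) (H1 S)) (adj1 : adjunction L1 (pull H1 p))
    (L2 : functor (H2 P) (H2 S)) (adj2 : adjunction L2 (pull H2 p))
    (A : H1 P),
  sm P S p -> is_iso (sharp_comparison R adj1 adj2 A).

(* Main.v *)
(** Every [S] admits a closed immersion [z : S -> Y] with [Y] smooth over the point,
    and [A = z^* z_* A], so the extension has to send [A] to [z^* R_Y (z_* A)].

    If [z^* C = 0] then [C = u_# u^* C] for the complementary open immersion [u],
    hence [R_Y C = u_# R (u^* C)] because [R] is localic, and [z^* R_Y C = 0] by base
    change. So [z^* R_Y] inverts every morphism that [z^*] inverts.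

    Consider the triples [(W, h : S -> W, A)] with [W] in [U] and [A] in [H1 W],
    with [hom (h^* A) (h'^* A')] as morphisms. The above makes
    [(W, h, A) |-> h^* R_W A] a functor [Phi] on them: after embedding [S] in a
    common [V] over [W] and [W'], a morphism is a fraction [(k^* e)^-1 (k^* d)] of
    morphisms of [H1 V], and [Phi] sends it to [(k^* R_V e)^-1 (k^* R_V d)]. Being
    compatible with pullbacks, shifts, connections and the [theta] of [R], [Phi]
    transports all the structure of [R], and the coherence of the extension reduces
    to identities between morphisms of [H1].

    Uniqueness holds because a 2-morphism is forced on [z^* N]. For localicity,
    stratifications and conservativity reduce the invertibility of a morphism over
    [S] to that of its pullbacks to objects of [U]. *)
From Stdlib Require Import FunctionalExtensionality ProofIrrelevance ClassicalEpsilon.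
From mathcomp Require Import ssreflect ssrfun ssrbool ssrnat.
Require Import Defs.

Set Implicit Arguments.
Unset Strict Implicit.
Unset Printing Implicit Defensive.
Local Open Scope cat_scope.

(* Seals a composite of morphisms, which rewriting with [composeA] would
   otherwise unfold. *)
Fact sealed (A : Type) (x : A) : {y | y = x}.
Proof. by exists x. Qed.

(** * Categories *)

Section Isomorphisms.
Variable C : category.
Implicit Types a b c d : C.

(* Variants of an equation between composites, ready to rewrite inside a longer
   left-associated composite. *)
Lemma comp22 a b b' c d (x : hom b c) (y : hom a b) (z : hom b' c) (t : hom a b') :
  x ∘ y = z ∘ t -> forall w : hom c d, w ∘ x ∘ y = w ∘ z ∘ t.
Proof. by move=> e w; rewrite -composeA e composeA. Qed.

Lemma comp23 a b b1 b2 c d (x : hom b c) (y : hom a b) (z : hom b1 c)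
    (t : hom b2 b1) (s : hom a b2) :
  x ∘ y = z ∘ t ∘ s -> forall w : hom c d, w ∘ x ∘ y = w ∘ z ∘ t ∘ s.
Proof. by move=> e w; rewrite -composeA e !composeA. Qed.

Lemma comp32 a b b1 b2 c d (x : hom b c) (y : hom a b) (z : hom b1 c)
    (t : hom b2 b1) (s : hom a b2) :
  z ∘ t ∘ s = x ∘ y -> forall w : hom c d, w ∘ z ∘ t ∘ s = w ∘ x ∘ y.
Proof. by move=> e w; rewrite -[RHS]composeA -e !composeA. Qed.

Definition inv a b (f : hom a b) (i : is_iso f) : hom b a :=
  proj1_sig (constructive_indefinite_description _ i).

Lemma invl a b (f : hom a b) (i : is_iso f) : inv i ∘ f = idc a.
Proof. by rewrite /inv; case: constructive_indefinite_description => g []. Qed.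

Lemma invr a b (f : hom a b) (i : is_iso f) : f ∘ inv i = idc b.
Proof. by rewrite /inv; case: constructive_indefinite_description => g []. Qed.

Lemma invlK a b c (f : hom a b) (i : is_iso f) (w : hom a c) : w ∘ inv i ∘ f = w.
Proof. by rewrite -composeA invl composec1. Qed.

Lemma invrK a b c (f : hom a b) (i : is_iso f) (w : hom b c) : w ∘ f ∘ inv i = w.
Proof. by rewrite -composeA invr composec1. Qed.

Lemma iso_id a : is_iso (idc a).
Proof. by exists (idc a); rewrite compose1c. Qed.

Lemma iso_inv a b (f : hom a b) (i : is_iso f) : is_iso (inv i).
Proof. by exists f; rewrite invl invr. Qed.

Lemma iso_comp a b c (g : hom b c) (f : hom a b) :
  is_iso g -> is_iso f -> is_iso (g ∘ f).
Proof.
move=> ig jf; exists (inv jf ∘ inv ig).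
by rewrite !composeA !invlK !invrK invl invr.
Qed.

Lemma iso_mono a b c (f : hom b c) (g h : hom a b) :
  is_iso f -> f ∘ g = f ∘ h -> g = h.
Proof.
by move=> i e; rewrite -[g]compose1c -[h]compose1c -(invl i) -!composeA e.
Qed.

Lemma iso_epi a b c (f : hom a b) (g h : hom b c) :
  is_iso f -> g ∘ f = h ∘ f -> g = h.
Proof.
by move=> i e; rewrite -[g]composec1 -[h]composec1 -(invr i) !composeA e.
Qed.

Lemma iso_cancel_l a b c (g : hom b c) (f : hom a b) :
  is_iso g -> is_iso (g ∘ f) -> is_iso f.
Proof.
move=> ig igf; have -> : f = inv ig ∘ (g ∘ f) by rewrite composeA invl compose1c.
exact: iso_comp (iso_inv ig) igf.
Qed.

Lemma iso_cancel_r a b c (g : hom b c) (f : hom a b) :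
  is_iso f -> is_iso (g ∘ f) -> is_iso g.
Proof.
move=> jf igf; have -> : g = g ∘ f ∘ inv jf by rewrite invrK.
exact: iso_comp igf (iso_inv jf).
Qed.

Lemma iso_solve a b c (f : hom b c) (g : hom a c) : is_iso f -> exists h, f ∘ h = g.
Proof. by move=> i; exists (inv i ∘ g); rewrite composeA invr compose1c. Qed.

Lemma cast_iso a b (e : a = b) : is_iso (cast e).
Proof. by case: b / e; apply: iso_id. Qed.

Lemma zero_iso a b (f : hom a b) : is_zero a -> is_zero b -> is_iso f.
Proof.
move=> za zb; case: (za b) (zb a) => [[f1 [_ u1]] _] [[g [_ _]] _].
exists g; split.
  by case: (za a) => [[x [_ ux]] _]; rewrite -(ux (g ∘ f)) // -(ux (idc a)).
by case: (zb b) => [[x [_ ux]] _]; rewrite -(ux (f ∘ g)) // -(ux (idc b)).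
Qed.

Section Products.
Variables (a b s : C) (p : hom s a) (q : hom s b).
Hypothesis pq : is_product p q.

Lemma product_pair x (f : hom x a) (g : hom x b) :
  exists k : hom x s, p ∘ k = f /\ q ∘ k = g.
Proof. by case: (pq f g) => k [e _]; exists k. Qed.

Lemma product_inj x (k k' : hom x s) : p ∘ k = p ∘ k' -> q ∘ k = q ∘ k' -> k = k'.
Proof.
by move=> e1 e2; case: (pq (p ∘ k') (q ∘ k')) => m [_ u]; rewrite -(u k) // -(u k').
Qed.

End Products.

End Isomorphisms.

Lemma iso_fmap (C D : category) (F : functor C D) (a b : C) (f : hom a b) :
  is_iso f -> is_iso (fmap F f).
Proof. by case=> g [e1 e2]; exists (fmap F g); rewrite -!fmapM e1 e2 !fmap1. Qed.

Lemma fmapMr (C D : category) (F : functor C D) (a b c : C) (d : D)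
    (w : hom (F c) d) (g : hom b c) (f : hom a b) :
  w ∘ fmap F g ∘ fmap F f = w ∘ fmap F (g ∘ f).
Proof. by rewrite -composeA fmapM. Qed.

Lemma ni_iso (C D : category) (F G : functor C D) (n : nat_iso F G) (a : C) :
  is_iso (n a).
Proof. by exists (ni_inv n a); rewrite ni_invl ni_invr. Qed.

Lemma ni_inv_iso (C D : category) (F G : functor C D) (n : nat_iso F G) (a : C) :
  is_iso (ni_inv n a).
Proof. by exists (n a); rewrite ni_invl ni_invr. Qed.

Lemma nat_trans_eq (C D : category) (F G : functor C D) (s t : nat_trans F G) :
  (forall a, s a = t a) -> s = t.
Proof.
case: s t => s ps [t pt] /= e.
have est : s = t by apply: functional_extensionality_dep.
by case: t / est pt e => pt _; rewrite (proof_irrelevance _ ps pt).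
Qed.

Lemma nat_iso_eq (C D : category) (F G : functor C D) (s t : nat_iso F G) :
  (forall a, s a = t a) -> s = t.
Proof.
case: s t => s s' l r [t t' l' r'] /= /nat_trans_eq e; case: t / e l' r' => l' r'.
have e' : s' = t'.
  apply: nat_trans_eq => a; rewrite -[s' a]composec1 -(r' a) composeA l.
  by rewrite compose1c.
case: t' / e' l' r' => l' r'.
by rewrite (proof_irrelevance _ l l') (proof_irrelevance _ r r').
Qed.

Section NatIso.
Variables (C D : category) (F G : functor C D) (t : nat_trans F G).
Hypothesis it : forall a, is_iso (t a).

Lemma inv_natural (a b : C) (f : hom a b) :
  inv (it b) ∘ fmap G f = fmap F f ∘ inv (it a).
Proof.
apply: (iso_mono (it b)); rewrite !composeA invr compose1c nt_natural.
by rewrite -composeA invr composec1.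
Qed.

Definition nat_iso_of : nat_iso F G :=
  @NatIso C D F G t (NatTrans inv_natural) (fun a => invl (it a)) (fun a => invr (it a)).

End NatIso.

Section FullyFaithful.
Variables (C D : category) (F : functor C D).
Hypothesis ff : fully_faithful F.

Lemma ff_inj (a b : C) (f g : hom a b) : fmap F f = fmap F g -> f = g.
Proof. by case: (ff (fmap F g)) => x [_ u] e; rewrite -(u f e) -(u g erefl). Qed.

Definition ff_lift (a b : C) (g : hom (F a) (F b)) : hom a b :=
  proj1_sig (constructive_indefinite_description _ (ff g)).

Lemma ff_liftK (a b : C) (g : hom (F a) (F b)) : fmap F (ff_lift g) = g.
Proof. by rewrite /ff_lift; case: constructive_indefinite_description => f []. Qed.

Lemma ff_iso (a b : C) (f : hom a b) : is_iso (fmap F f) -> is_iso f.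
Proof.
move=> i; exists (ff_lift (inv i)).
by split; apply: ff_inj; rewrite fmapM fmap1 ff_liftK ?invl ?invr.
Qed.

End FullyFaithful.

(** * Adjunctions and transposes *)

Section Adjunctions.
Variables (C D : category) (L : functor D C) (F : functor C D).
Variable adj : adjunction L F.

Definition adj_unit (b : D) : hom b (F (L b)) := unit_of adj b.
Definition adj_counit (a : C) : hom (L (F a)) a := counit_of adj a.

Lemma adj_unit_nat (a b : D) (f : hom a b) :
  adj_unit b ∘ f = fmap F (fmap L f) ∘ adj_unit a.
Proof. exact: (nt_natural (unit_of adj) f). Qed.

Lemma adj_counit_nat (a b : C) (f : hom a b) :
  adj_counit b ∘ fmap L (fmap F f) = f ∘ adj_counit a.
Proof. exact: (nt_natural (counit_of adj) f). Qed.

Lemma adj_triangleL (b : D) : adj_counit (L b) ∘ fmap L (adj_unit b) = idc (L b).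
Proof. exact: (triangleL adj). Qed.

Lemma adj_triangleR (a : C) : fmap F (adj_counit a) ∘ adj_unit (F a) = idc (F a).
Proof. exact: (triangleR adj). Qed.

Definition transpose (a : C) (b : D) (g : hom (L b) a) : hom b (F a) :=
  sval (sealed (fmap F g ∘ adj_unit b)).

Lemma transposeE (a : C) (b : D) (g : hom (L b) a) :
  transpose g = fmap F g ∘ adj_unit b.
Proof. exact: svalP (sealed _). Qed.

Lemma transpose_inj (a : C) (b : D) (g h : hom (L b) a) :
  transpose g = transpose h -> g = h.
Proof.
have K (x : hom (L b) a) : adj_counit a ∘ fmap L (transpose x) = x.
  by rewrite transposeE fmapM composeA adj_counit_nat -composeA adj_triangleL composec1.
by move=> e; rewrite -(K g) -(K h) e.
Qed.

Lemma transpose_counit (a : C) (b : D) (f : hom b (F a)) :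
  transpose (adj_counit a ∘ fmap L f) = f.
Proof.
by rewrite transposeE fmapM -composeA -adj_unit_nat composeA adj_triangleR compose1c.
Qed.

Lemma transpose_comp (a : C) (b b' : D) (g : hom (L b) a) (x : hom b' b) :
  transpose g ∘ x = transpose (g ∘ fmap L x).
Proof. by rewrite !transposeE fmapM -!composeA adj_unit_nat. Qed.

Lemma fmap_transpose (a a' : C) (b : D) (y : hom a a') (g : hom (L b) a) :
  fmap F y ∘ transpose g = transpose (y ∘ g).
Proof. by rewrite !transposeE fmapM composeA. Qed.

Lemma transpose_id (b : D) : transpose (idc (L b)) = adj_unit b.
Proof. by rewrite transposeE fmap1 compose1c. Qed.

(** The inverse is the lift of the unit at [F a] through [F]; each triangle identity gives one of
    the two equations. *)
Lemma adj_counit_iso : fully_faithful F -> forall a, is_iso (adj_counit a).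
Proof.
move=> ff a; pose g : hom a (L (F a)) := ff_lift ff (adj_unit (F a)).
have gE : fmap F g = adj_unit (F a) by apply: ff_liftK.
have eg : adj_counit a ∘ g = idc a.
  by apply: (ff_inj ff); rewrite fmapM gE adj_triangleR fmap1.
exists g; split=> //.
rewrite -adj_counit_nat gE; exact: adj_triangleL.
Qed.

(** For a closed immersion z, z^* inverts N -> z_* z^* N; this unit serves below as a universal
    denominator. *)
Lemma fmap_unit_iso : fully_faithful F -> forall b, is_iso (fmap L (adj_unit b)).
Proof.
move=> ff b; apply: (iso_cancel_l (adj_counit_iso ff (L b))).
by rewrite adj_triangleL; apply: iso_id.
Qed.

End Adjunctions.

(* Only the structure morphisms need comparing, since the functors are the same. *)
Lemma tri_mor_eq (C : category) (H1 H2 : tri_fibered C) (R : tri_mor H1 H2)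
    (t : forall (T S : C) (f : hom T S),
      nat_iso (fcomp (pull H2 f) (R S)) (fcomp (R T) (pull H1 f))) c s :
  (forall (T S : C) (f : hom T S), t T S f = theta R f) ->
  @TriMor C H1 H2 (@FibMor C H1 H2 (fun S => R S) t c)
    (fun S => tri_mor_at R S) s = R.
Proof.
case: R t c s => [[m t' c'] tm s'] /= t c s E.
have Et : t = t' by do 3!apply: functional_extensionality_dep => ?.
subst t'.
have Ec := proof_irrelevance _ c c'; subst c'.
by rewrite (proof_irrelevance _ s s').
Qed.

(** * Triangulated categories *)

Section Additive.
Variables (C : category) (aC : additive C).
Implicit Types a b c : C.

Lemma addh0 a b (f : hom a b) : addh aC f (zeroh aC a b) = f.
Proof. by rewrite addhC add0h. Qed.

Lemma addhN a b (f : hom a b) : addh aC f (opph aC f) = zeroh aC a b.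
Proof. by rewrite addhC addNh. Qed.

Lemma addh_inj a b (f g h : hom a b) : addh aC f g = addh aC f h -> g = h.
Proof.
by move=> e; rewrite -(add0h aC g) -(add0h aC h) -(addNh aC f) -!addhA e.
Qed.

Lemma comp0h a b c (f : hom a b) : zeroh aC b c ∘ f = zeroh aC a c.
Proof. by apply: (@addh_inj _ _ (zeroh aC b c ∘ f)); rewrite -compDl add0h addh0. Qed.

Lemma comph0 a b c (f : hom b c) : f ∘ zeroh aC a b = zeroh aC a c.
Proof. by apply: (@addh_inj _ _ (f ∘ zeroh aC a b)); rewrite -compDr add0h addh0. Qed.

Lemma opph_uniq a b (f g : hom a b) : addh aC f g = zeroh aC a b -> g = opph aC f.
Proof. by move=> e; apply: (@addh_inj _ _ f); rewrite e addhN. Qed.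

Lemma compNh a b c (g : hom b c) (f : hom a b) : opph aC g ∘ f = opph aC (g ∘ f).
Proof. by apply: opph_uniq; rewrite -compDl addhN comp0h. Qed.

Lemma comphN a b c (g : hom b c) (f : hom a b) : g ∘ opph aC f = opph aC (g ∘ f).
Proof. by apply: opph_uniq; rewrite -compDr addhN comph0. Qed.

Lemma opphK a b (f : hom a b) : opph aC (opph aC f) = f.
Proof. by apply/esym/opph_uniq; rewrite addNh. Qed.

Lemma opph0 a b : opph aC (zeroh aC a b) = zeroh aC a b.
Proof. by apply/esym/opph_uniq; rewrite add0h. Qed.

Lemma opph_inj a b (f g : hom a b) : opph aC f = opph aC g -> f = g.
Proof. by move=> e; rewrite -(opphK f) e opphK. Qed.

Lemma subh_eq0 a b (f g : hom a b) :
  addh aC f (opph aC g) = zeroh aC a b -> f = g.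
Proof. by move=> e; apply: opph_inj; rewrite (opph_uniq e). Qed.

Lemma is_zeroP (z : C) : is_zero z <-> idc z = zeroh aC z z.
Proof.
split=> [hz | e].
  by case: (hz z) => [[f [_ u]] _]; rewrite -(u (idc z)) // -(u (zeroh aC z z)).
move=> a; split.
  by exists (zeroh aC z a); split=> // f _; rewrite -[RHS]composec1 e comph0.
by exists (zeroh aC a z); split=> // f _; rewrite -[RHS]compose1c e comp0h.
Qed.

Lemma initial_zero (z : C) : (forall f g : hom z z, f = g) -> is_zero z.
Proof. by move=> h; apply/is_zeroP. Qed.

Lemma zero_of_iso a b (f : hom a b) : is_iso f -> is_zero a -> is_zero b.
Proof.
case=> g [_ fg] /is_zeroP e; apply/is_zeroP.
by rewrite -fg -[f]composec1 e comph0 comp0h.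
Qed.

End Additive.
Arguments is_zeroP {C} aC z.

(** Transposition determines a morphism into [F b] by its image under [L]. Applied to z_*, which is
    given only as a right adjoint. *)
Lemma additive_right_adjoint (C D : category) (aC : additive C) (aD : additive D)
    (L : functor D C) (F : functor C D) :
  adjunction L F -> additive_functor aD aC L -> additive_functor aC aD F.
Proof.
move=> adj addL a b f g.
have K (x : hom (F a) (F b)) : x = transpose adj (adj_counit adj b ∘ fmap L x).
  by rewrite transpose_counit.
rewrite [LHS]K [RHS]K addL compDr !adj_counit_nat; congr transpose.
by rewrite compDl.
Qed.

(* A left adjoint preserves initial objects, hence zero objects. *)
Lemma left_adjoint_zero (C D : category) (aC : additive C)
    (L : functor D C) (F : functor C D) (z : D) :
  adjunction L F -> is_zero z -> is_zero (L z).
Proof.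
move=> adj hz; apply: (initial_zero aC) => f g.
apply: (transpose_inj (adj := adj)).
case: (hz (F (L z))) => [[x [_ u]] _].
by rewrite -(u (transpose adj f)) // -(u (transpose adj g)).
Qed.

(** * Exactness properties of distinguished triangles and the five lemma *)

Section Triangles.
Variables (C : category) (tC : triangulated C).
Local Notation "0" := (zeroh tC _ _) : cat_scope.

Section OneTriangle.
Variables (X Y Z : C) (f : hom X Y) (g : hom Y Z) (h : hom Z (shift tC X)).
Hypothesis tri_fgh : dist f g h.

Lemma dist_rot : dist g h (opph tC (fmap (shift tC) f)).
Proof. exact: (proj1 (TR2 _ _ _) tri_fgh). Qed.

Lemma dist_comp0 : g ∘ f = 0.
Proof.
case: (has_zero tC) => z hz.
have [k [<- _]] := TR3 (i := idc X) (j := f) (TR1_id tC X hz) tri_fgh erefl.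
by rewrite comph0.
Qed.

(** TR3 maps the rotated triangle A -> 0 -> A[1] to the rotation of the given one; the third
    component A[1] -> X[1] comes from some A -> X because the shift is full. *)
Lemma dist_exact (A : C) (x : hom A Y) : g ∘ x = 0 -> exists y, x = f ∘ y.
Proof.
case: (has_zero tC) => z hz e.
have t1 : dist _ _ _ := proj1 (TR2 _ _ _) (TR1_id tC A hz).
have [|k [_ e2]] := TR3 (i := x) (j := 0) t1 dist_rot; first by rewrite e comp0h.
exists (ff_lift (@shift_ff _ tC) k); apply: (ff_inj (@shift_ff _ tC)).
rewrite fmapM ff_liftK; move: e2.
by rewrite fmap1 comphN compNh composec1 => /opph_inj.
Qed.

End OneTriangle.

Section TriangleExactness.
Variables (X Y Z : C) (f : hom X Y) (g : hom Y Z) (h : hom Z (shift tC X)).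
Hypothesis tri_fgh : dist f g h.

Lemma dist_exact2 (A : C) (x : hom A Z) : h ∘ x = 0 -> exists y, x = g ∘ y.
Proof. exact: dist_exact (dist_rot tri_fgh) _ x. Qed.

Lemma dist_exact3 (A : C) (x : hom A (shift tC X)) :
  fmap (shift tC) f ∘ x = 0 -> exists y, x = h ∘ y.
Proof.
move=> e; apply: (dist_exact (dist_rot (dist_rot tri_fgh))).
by rewrite compNh e opph0.
Qed.

Lemma shift_dist_comp0 : fmap (shift tC) f ∘ h = 0.
Proof.
have := dist_comp0 (dist_rot (dist_rot tri_fgh)).
by rewrite compNh -[RHS](opph0 tC) => /opph_inj.
Qed.

Lemma cone_zero_iso : is_zero Z -> is_iso f.
Proof.
move=> hz.
have to0 A (x y : hom A Z) : x = y.
  by case: (hz A) => _ [t [_ u]]; rewrite -(u x) // -(u y).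
have [k /esym kr] : exists k, idc Y = f ∘ k by apply: (dist_exact tri_fgh); apply: to0.
exists k; split=> //; apply: (ff_inj (@shift_ff _ tC)); apply: (subh_eq0 (aC := tC)).
(* [d] is the shift of [k ∘ f] minus the identity. It is killed by the shift of [f], hence factors
   through [h], and so vanishes. *)
set d := addh _ _ _.
have [|y ->] := @dist_exact3 _ d.
  by rewrite /d compDr comphN -!fmapM composeA kr compose1c composec1 addhN.
have -> : y = 0 by apply: to0.
by rewrite comph0.
Qed.

(** The identity of [Z] is killed by [h], because the shift of [f] is monic, so it factors through
    [g], which vanishes because [f] is epic. *)
Lemma iso_cone_zero : is_iso f -> is_zero Z.
Proof.
move=> i; apply/(is_zeroP tC).
have [|y ->] := @dist_exact2 _ (idc Z).
  apply: (iso_mono (iso_fmap (shift tC) i)).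
  by rewrite composec1 comph0 shift_dist_comp0.
have -> : g = 0 by apply: (iso_epi i); rewrite (dist_comp0 tri_fgh) comp0h.
by rewrite comp0h.
Qed.

End TriangleExactness.

(** A chase with generalized elements: [k] has trivial kernel and a section [m], and [k] kills
    [m ∘ k] minus the identity. *)
Lemma five_lemma (X Y Z X' Y' Z' : C)
    (f : hom X Y) (g : hom Y Z) (h : hom Z (shift tC X))
    (f' : hom X' Y') (g' : hom Y' Z') (h' : hom Z' (shift tC X'))
    (i : hom X X') (j : hom Y Y') (k : hom Z Z') :
  dist f g h -> dist f' g' h' -> is_iso i -> is_iso j ->
  j ∘ f = f' ∘ i -> k ∘ g = g' ∘ j -> fmap (shift tC) i ∘ h = h' ∘ k -> is_iso k.
Proof.
move=> t t' ii ij e1 e2 e3.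
have si := iso_fmap (shift tC) ii; have sj := iso_fmap (shift tC) ij.
have mono A (x : hom A Z) : k ∘ x = 0 -> x = 0.
  move=> ex; have [|y ey] := @dist_exact2 _ _ _ _ _ _ t _ x.
    by apply: (iso_mono si); rewrite composeA e3 -composeA ex !comph0.
  have [|w ew] := @dist_exact _ _ _ _ _ _ t' _ (j ∘ y).
    by rewrite composeA -e2 -composeA -ey.
  have ey' : y = f ∘ (inv ii ∘ w).
    by apply: (iso_mono ij); rewrite ew !composeA e1 -(composeA f') invr composec1.
  by rewrite ey ey' composeA (dist_comp0 t) comp0h.
(* Lift [inv si ∘ h'] along [h] to [y]; then the identity minus [k ∘ y] is killed by [h'], so it
   comes from [Y'] and can be corrected through [inv ij]. *)
have [m em] : exists m, idc Z' = k ∘ m.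
  pose w := inv si ∘ h'.
  have [|y ey] := @dist_exact3 _ _ _ _ _ _ t _ w.
    apply: (iso_mono sj); rewrite /w !composeA -fmapM e1 fmapM invrK.
    by rewrite (shift_dist_comp0 t') comph0.
  have [|v ev] := @dist_exact2 _ _ _ _ _ _ t' _ (addh tC (idc Z') (opph tC (k ∘ y))).
    rewrite compDr comphN composec1 composeA -e3 -composeA -ey /w composeA invr.
    by rewrite compose1c addhN.
  exists (addh tC (g ∘ (inv ij ∘ v)) y).
  by rewrite compDr !composeA e2 invrK -ev -addhA addNh addh0.
exists m; split=> //; apply: (subh_eq0 (aC := tC)); apply: mono.
by rewrite compDr comphN composeA -em compose1c composec1 addhN.
Qed.

End Triangles.

Section TriangulatedFunctors.
Variables (C D : category) (tC : triangulated C) (tD : triangulated D).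

Lemma tri_functor_iso (F : functor C D) (tF : tri_functor tC tD F)
    (X Y Z : C) (f : hom X Y) (g : hom Y Z) (h : hom Z (shift tC X)) :
  dist f g h -> is_zero (F Z) -> is_iso (fmap F f).
Proof. by move=> t; apply: cone_zero_iso (tf_dist tF t). Qed.

Lemma tri_functor_zero (F : functor C D) (tF : tri_functor tC tD F)
    (X Y Z : C) (f : hom X Y) (g : hom Y Z) (h : hom Z (shift tC X)) :
  dist f g h -> is_iso (fmap F f) -> is_zero (F Z).
Proof. by move=> t; apply: iso_cone_zero (tf_dist tF t). Qed.

End TriangulatedFunctors.

(** * Connection isomorphisms and shifts *)

Section Connections.
Variables (C : category) (H : fibered C).

(* The composite is only given up to a propositional equality, so that the
   associativity and unit laws of the base need no transport. *)
Definition conn_eq (S V W : C) (k : hom S V) (a : hom V W) (h : hom S W)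
    (e : h = a ∘ k) (A : H W) : hom (pull H h A) (pull H k (pull H a A)) :=
  sval (sealed (conn H k a A ∘ cast (congr1 (fun m => pull H m A) e))).

Lemma conn_eqE (S V W : C) (k : hom S V) (a : hom V W) (h : hom S W)
    (e : h = a ∘ k) (A : H W) :
  conn_eq e A = conn H k a A ∘ cast (congr1 (fun m => pull H m A) e).
Proof. exact: svalP (sealed _). Qed.

Lemma conn_eq_nat (S V W : C) (k : hom S V) (a : hom V W) (h : hom S W)
    (e : h = a ∘ k) (A A' : H W) (x : hom A A') :
  conn_eq e A' ∘ fmap (pull H h) x = fmap (pull H k) (fmap (pull H a) x) ∘ conn_eq e A.
Proof.
subst h; rewrite !conn_eqE /= !composec1; exact: (nt_natural (conn H k a) x).
Qed.

Lemma conn_eq_iso (S V W : C) (k : hom S V) (a : hom V W) (h : hom S W)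
    (e : h = a ∘ k) (A : H W) : is_iso (conn_eq e A).
Proof.
by rewrite conn_eqE; apply: iso_comp; [exact: (ni_iso (conn H k a)) | exact: cast_iso].
Qed.

Lemma conn_eq_conn (S V W : C) (k : hom S V) (a : hom V W) (A : H W) :
  conn_eq (erefl (a ∘ k)) A = conn H k a A.
Proof. by rewrite conn_eqE composec1. Qed.

Lemma conn_eq_assoc (S V V0 W : C) (k : hom S V) (b : hom V V0) (a : hom V0 W)
    (m : hom S V0) (n : hom V W) (h : hom S W)
    (en : n = a ∘ b) (e1 : h = n ∘ k) (em : m = b ∘ k) (e2 : h = a ∘ m) (A : H W) :
  fmap (pull H k) (conn_eq en A) ∘ conn_eq e1 A = conn_eq em (pull H a A) ∘ conn_eq e2 A.
Proof.
subst m n; subst h.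
have := conn_cocycle k b a A; rewrite !conn_eq_conn.
rewrite !conn_eqE (proof_irrelevance _ e2 (esym (composeA a b k))) => ->.
exact: esym (composeA _ _ _).
Qed.

(** A property invariant under rewriting with [pull_id]; stating coherence through it leaves no cast
    between fibres. *)
Lemma pull_id_ff (S : C) : fully_faithful (pull H (idc S)).
Proof.
rewrite pull_id => a b g.
by exists g; split.
Qed.

(* [pull_id] is an equality of plain functors and the connection of two identities
   may differ from the identity; this is the isomorphism of [A] with [id^* A] that is
   coherent with the connections. *)
Definition id_pull (S : C) (A : H S) : hom A (pull H (idc S) A) :=
  ff_lift (@pull_id_ff S) (conn_eq (esym (compose1c (idc S))) A).

Lemma pull_id_id_pull (S : C) (e : idc S = idc S ∘ idc S) (A : H S) :
  fmap (pull H (idc S)) (id_pull A) = conn_eq e A.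
Proof. by rewrite ff_liftK (proof_irrelevance _ e (esym (compose1c (idc S)))). Qed.

Lemma id_pull_iso (S : C) (A : H S) : is_iso (id_pull A).
Proof.
apply: (ff_iso (@pull_id_ff S)).
by rewrite (pull_id_id_pull (esym (compose1c (idc S)))); apply: conn_eq_iso.
Qed.

Lemma id_pull_nat (S : C) (A A' : H S) (x : hom A A') :
  id_pull A' ∘ x = fmap (pull H (idc S)) x ∘ id_pull A.
Proof.
apply: (ff_inj (@pull_id_ff S)).
rewrite !fmapM !(pull_id_id_pull (esym (compose1c (idc S)))); exact: conn_eq_nat.
Qed.

Lemma inv_id_pull_nat (S : C) (A A' : H S) (x : hom A A') :
  inv (id_pull_iso A') ∘ fmap (pull H (idc S)) x = x ∘ inv (id_pull_iso A).
Proof.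
apply: (iso_mono (id_pull_iso A')); rewrite !composeA invr compose1c id_pull_nat.
by rewrite -composeA invr composec1.
Qed.

(** As for the unit coherences of a monoidal category, this and [id_pull_pull] come from the cocycle
    condition on a triple with two identities, by cancelling isomorphisms. *)
Lemma pull_id_pull (T S : C) (f : hom T S) (e : f = idc S ∘ f) (A : H S) :
  fmap (pull H f) (id_pull A) = conn_eq e A.
Proof.
have e0 : idc S = idc S ∘ idc S by rewrite compose1c.
have := conn_eq_assoc e0 e e e A.
move/(iso_epi (conn_eq_iso e A)); rewrite -(pull_id_id_pull e0) -/(pull H f).
move=> E; apply: (iso_mono (conn_eq_iso e (pull H (idc S) A))).
by rewrite conn_eq_nat E.
Qed.

Lemma id_pull_pull (T S : C) (f : hom T S) (e : f = f ∘ idc T) (A : H S) :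
  id_pull (pull H f A) = conn_eq e A.
Proof.
have e0 : idc T = idc T ∘ idc T by rewrite compose1c.
apply: (ff_inj (@pull_id_ff T)); rewrite (pull_id_id_pull e0).
by have /(iso_epi (conn_eq_iso e A)) := conn_eq_assoc e e e0 e A.
Qed.

Lemma id_pull_conn_eq (T S : C) (f h : hom T S) (eh : h = f) (e1 : h = idc S ∘ f)
    (e2 : h = f ∘ idc T) (A : H S) :
  fmap (pull H f) (inv (id_pull_iso A)) ∘ conn_eq e1 A
  = inv (id_pull_iso (pull H f A)) ∘ conn_eq e2 A.
Proof.
by subst h; rewrite -pull_id_pull -fmapM -id_pull_pull !invl fmap1.
Qed.

End Connections.

Section Shifts.
Variables (C : category) (H : tri_fibered C).

Definition pull_shift (T S : C) (f : hom T S) (A : H S) :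
    hom (pull H f (shift (tri H S) A)) (shift (tri H T) (pull H f A)) :=
  tf_shift (tri_pull H f) A.

Lemma pull_shift_iso (T S : C) (f : hom T S) (A : H S) : is_iso (pull_shift f A).
Proof. exact: (ni_iso (tf_shift (tri_pull H f))). Qed.

Lemma pull_shift_nat (T S : C) (f : hom T S) (A A' : H S) (x : hom A A') :
  pull_shift f A' ∘ fmap (pull H f) (fmap (shift (tri H S)) x)
  = fmap (shift (tri H T)) (fmap (pull H f) x) ∘ pull_shift f A.
Proof. exact: (nt_natural (tf_shift (tri_pull H f)) x). Qed.

Lemma conn_eq_shift (S V W : C) (k : hom S V) (a : hom V W) (h : hom S W)
    (e : h = a ∘ k) (A : H W) :
  fmap (shift (tri H S)) (conn_eq e A) ∘ pull_shift h A
  = pull_shift k (pull H a A) ∘ fmap (pull H k) (pull_shift a A)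
    ∘ conn_eq e (shift (tri H W) A).
Proof.
subst h; rewrite !conn_eq_conn; exact: esym (@tri_conn _ H _ _ _ k a A).
Qed.

Lemma id_pull_shift (S : C) (A : H S) :
  pull_shift (idc S) A ∘ id_pull (shift (tri H S) A) = fmap (shift (tri H S)) (id_pull A).
Proof.
have e0 : idc S = idc S ∘ idc S by rewrite compose1c.
apply: (ff_inj (@pull_id_ff _ H S)); rewrite fmapM (pull_id_id_pull e0).
apply: (iso_mono (pull_shift_iso (idc S) (pull H (idc S) A))).
by rewrite composeA -conn_eq_shift pull_shift_nat (pull_id_id_pull e0).
Qed.

Lemma inv_id_pull_shift (S : C) (A : H S) :
  fmap (shift (tri H S)) (inv (id_pull_iso A)) ∘ pull_shift (idc S) A
  = inv (id_pull_iso (shift (tri H S) A)).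
Proof.
apply: (iso_epi (id_pull_iso (shift (tri H S) A))).
by rewrite -composeA id_pull_shift -fmapM !invl fmap1.
Qed.

End Shifts.

(** * Closed immersions and open complements *)

Section Base.
Variable B : base.

Lemma inU_smooth (P S : B) (p : hom P S) : smooth p -> inU S -> inU P.
Proof. by move=> sp sS; rewrite /inU -(to_pt_uniq (to_pt S ∘ p)); apply: smooth_comp. Qed.

Lemma U_product (V W : U B) :
  exists (P : U B) (p : @hom B (sval P) (sval V)) (q : @hom B (sval P) (sval W)),
    is_product p q.
Proof.
case: V W => [V hV] [W hW]; have [P [p [q pq]]] := base_prods V W.
have cart : cartesian (to_pt V) (to_pt W) p q.
  split; first by rewrite (to_pt_uniq (to_pt V ∘ p)) (to_pt_uniq (to_pt W ∘ q)).
  by move=> X a b _; apply: pq.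
by exists (exist _ P (inU_smooth (smooth_pullback hV cart) hW)), p, q.
Qed.

Lemma closed_embedding (S : B) : exists (Y : U B) (s : hom S (sval Y)), closed s.
Proof.
have [P [s [p [cs sp _]]]] := factorization (to_pt S).
have sP : inU P by rewrite /inU -(to_pt_uniq p).
by exists (exist _ P sP), s.
Qed.

Lemma closed_over (S : B) (W : U B) (h : @hom B S (sval W)) :
  exists (V : U B) (k : @hom B S (sval V)) (c : @hom B (sval V) (sval W)),
    closed k /\ h = c ∘ k.
Proof.
have [P [k [c [ck sc e]]]] := factorization h.
by exists (exist _ P (inU_smooth sc (svalP W))), k, c.
Qed.

Lemma compl_cartesian (Z S : B) (z : hom Z S) (hz : closed z) :
  cartesian (compl_mor hz) z (from_empty (compl hz)) (from_empty Z).
Proof.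
by apply/(compl_image hz); exists (idc _); rewrite composec1.
Qed.

(** An open immersion is a monomorphism, so it is its own self-intersection; base change along this
    square makes u_# fully faithful. *)
Lemma compl_mono (Z S : B) (z : hom Z S) (hz : closed z) :
  cartesian (compl_mor hz) (compl_mor hz) (idc _) (idc _).
Proof.
split=> // X a b /compl_inj ->; exists b; split; first by rewrite compose1c.
by move=> k []; rewrite compose1c.
Qed.

End Base.

Definition id_adjunction (C : category) : adjunction (fid C) (fid C) :=
  @Adjunction C C (fid C) (fid C)
    (@NatTrans C C (fid C) (fcomp (fid C) (fid C)) (fun a => idc a)
      (nt_natural (nt_id (fid C))))
    (@NatTrans C C (fcomp (fid C) (fid C)) (fid C) (fun a => idc a)
      (nt_natural (nt_id (fid C))))
    (fun a => compose1c (idc a)) (fun a => compose1c (idc a)).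

Section Vanishing.
Variables (B : base) (H : tri_fibered B).
Hypothesis loc : localic H.
Variables (Z S : B) (z : hom Z S) (hz : closed z).
Let u := compl_mor hz.
Variables (L : functor (H (compl hz)) (H S)) (adj : adjunction L (pull H u)).

(** [Z] and its complement meet in the empty object, so base change identifies z^* u_# X with the
    image of a zero object under a left adjoint. *)
Lemma pull_sharp_zero (X : H (compl hz)) : is_zero (pull H z (L X)).
Proof.
have cart := compl_cartesian hz.
have [L' [adj']] := localic_left_adj loc (smooth_pullback (compl_smooth hz) cart).
have i := localic_base_change loc adj adj' cart X (compl_smooth hz).
apply: (zero_of_iso (tri H Z) i).
apply: (left_adjoint_zero (tri H Z) adj'); exact: localic_empty.
Qed.

(** Base change along [compl_mono], whose projections are identities: up to isomorphisms the
    exchange morphism is the pullback of the unit along the identity. *)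
Lemma open_unit_iso (X : H (compl hz)) : is_iso (adj_unit adj X).
Proof.
have [adj'] : inhabited (adjunction (fid _) (pull H (idc (compl hz)))).
  by rewrite pull_id; exists; apply: id_adjunction.
have ci := adj_counit_iso adj' (@pull_id_ff _ H (compl hz)).
have i := localic_base_change loc adj adj' (compl_mono hz) X (compl_smooth hz).
apply: (ff_iso (@pull_id_ff _ H (compl hz))).
have {i} := iso_cancel_l (ci _) i.
apply: iso_cancel_l; apply: iso_comp; first last.
  exact: (ni_inv_iso (conn H (idc _) u)).
by apply: iso_comp; [exact: (ni_iso (conn H (idc _) u)) | exact: cast_iso].
Qed.

(** By conservativity: z^* makes both sides zero, and u^* of the counit is inverse to the invertible
    unit. *)
Lemma open_counit_iso (A : H S) : is_zero (pull H z A) -> is_iso (adj_counit adj A).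
Proof.
move=> hA; apply: (localic_conservative loc (hz := hz)).
  exact: zero_iso (pull_sharp_zero _) hA.
apply: (iso_cancel_r (open_unit_iso _)).
by rewrite adj_triangleR; apply: iso_id.
Qed.

End Vanishing.

(** * Existence of the extension *)

Section Extension.
Variables (B : base) (H1 H2 : tri_fibered B).
Hypotheses (loc1 : localic H1) (loc2 : localic H2).
Variable R : tri_mor (restr_tri (@inU B) H1) (restr_tri (@inU B) H2).
Hypothesis locR : localic_mor (@smoothU B) R.

(** The fibres and pullbacks that [R] relates are those of [H1] and [H2] only up to conversion.
    [RU], [theta_U] and [RU_shift] restate its data over the base itself, so that rewriting
    applies. *)
Definition RU (V : U B) : functor (H1 (sval V)) (H2 (sval V)) := R V.

Definition theta_U (V W : U B) (a : @hom B (sval V) (sval W)) (A : H1 (sval W)) :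
    hom (pull H2 a (RU W A)) (RU V (pull H1 a A)) :=
  @theta _ _ _ R V W a A.

Definition RU_shift (V : U B) (A : H1 (sval V)) :
    hom (RU V (shift (tri H1 _) A)) (shift (tri H2 _) (RU V A)) :=
  tf_shift (tri_mor_at R V) A.

Lemma closed_inverts_zero (S : B) (Y : U B) (z : @hom B S (sval Y)) (cz : closed z)
    (A : H1 (sval Y)) : is_zero (pull H1 z A) -> is_zero (pull H2 z (RU Y A)).
Proof.
move=> hA; have su := compl_smooth cz.
pose P : U B := exist _ (compl cz) (inU_smooth su (svalP Y)).
have [L1 [adj1]] := localic_left_adj loc1 su.
have [L2 [adj2]] := localic_left_adj loc2 su.
pose X := pull H1 (compl_mor cz) A.
have i1 : is_iso (adj_counit adj1 A) := open_counit_iso loc1 adj1 hA.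
have i2 := @locR P Y (compl_mor cz) L1 adj1 L2 adj2 X su.
(* Along z^* R(u_# X) -> z^* R(A) and z^* u_# R(X) -> z^* R(u_# X), both invertible, with [X] = u^*
   A. *)
apply: (zero_of_iso (tri H2 S) (iso_fmap (pull H2 z) (iso_fmap (RU Y) i1))).
apply: (zero_of_iso (tri H2 S) (iso_fmap (pull H2 z) i2)).
exact: (pull_sharp_zero loc2 adj2).
Qed.

(** A triangulated functor inverts a morphism exactly when it kills the cone, so the previous lemma
    applies to the cone of [x]. *)
Lemma closed_inverts (S : B) (Y : U B) (z : @hom B S (sval Y)) (A A' : H1 (sval Y))
    (x : hom A A') :
  closed z -> is_iso (fmap (pull H1 z) x) ->
  is_iso (fmap (pull H2 z) (fmap (RU Y) x)).
Proof.
move=> cz i; have [C [g [h t]]] := TR1_cone (tri H1 _) x.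
have hC := closed_inverts_zero cz (tri_functor_zero (tri_pull H1 z) t i).
exact: (tri_functor_iso (tri_pull H2 z) (tf_dist (tri_mor_at R Y) t)).
Qed.

Lemma theta_U_nat (V W : U B) (a : @hom B (sval V) (sval W)) (A A' : H1 (sval W))
    (x : hom A A') :
  theta_U a A' ∘ fmap (pull H2 a) (fmap (RU W) x)
  = fmap (RU V) (fmap (pull H1 a) x) ∘ theta_U a A.
Proof. exact: (nt_natural (@theta _ _ _ R V W a) x). Qed.

Lemma theta_U_iso (V W : U B) (a : @hom B (sval V) (sval W)) (A : H1 (sval W)) :
  is_iso (theta_U a A).
Proof. exact: (ni_iso (@theta _ _ _ R V W a)). Qed.

Lemma theta_U_cocycle (V V0 W : U B) (b : @hom B (sval V) (sval V0))
    (a : @hom B (sval V0) (sval W)) (n : @hom B (sval V) (sval W)) (e : n = a ∘ b)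
    (A : H1 (sval W)) :
  fmap (RU V) (conn_eq e A) ∘ theta_U n A
  = theta_U b (pull H1 a A) ∘ fmap (pull H2 b) (theta_U a A) ∘ conn_eq e (RU W A).
Proof. subst n; rewrite !conn_eq_conn; exact: (@theta_cocycle _ _ _ R V V0 W b a A). Qed.

Lemma RU_shift_nat (V : U B) (A A' : H1 (sval V)) (x : hom A A') :
  RU_shift A' ∘ fmap (RU V) (fmap (shift (tri H1 _)) x)
  = fmap (shift (tri H2 _)) (fmap (RU V) x) ∘ RU_shift A.
Proof. exact: (nt_natural (tf_shift (tri_mor_at R V)) x). Qed.

Lemma RU_shift_iso (V : U B) (A : H1 (sval V)) : is_iso (RU_shift A).
Proof. exact: (ni_iso (tf_shift (tri_mor_at R V))). Qed.

Lemma theta_U_shift (V W : U B) (a : @hom B (sval V) (sval W)) (A : H1 (sval W)) :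
  RU_shift (pull H1 a A) ∘ fmap (RU V) (pull_shift a A) ∘ theta_U a (shift (tri H1 _) A)
  = fmap (shift (tri H2 _)) (theta_U a A)
    ∘ (pull_shift a (RU W A) ∘ fmap (pull H2 a) (RU_shift A)).
Proof. exact: (@tri_theta _ _ _ R V W a A). Qed.

(** * Shift and connection isomorphisms of the objects h^* R_W A *)

Section PulledShift.
Variables (S : B) (V : U B) (k : @hom B S (sval V)).

Definition pull_RU_shift (A : H1 (sval V)) :
    hom (pull H2 k (RU V (shift (tri H1 _) A)))
        (shift (tri H2 _) (pull H2 k (RU V A))) :=
  sval (sealed (pull_shift k (RU V A) ∘ fmap (pull H2 k) (RU_shift A))).

Lemma pull_RU_shiftE A :
  pull_RU_shift A = pull_shift k (RU V A) ∘ fmap (pull H2 k) (RU_shift A).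
Proof. exact: svalP (sealed _). Qed.

Lemma pull_RU_shift_iso A : is_iso (pull_RU_shift A).
Proof.
rewrite pull_RU_shiftE; exact: iso_comp (pull_shift_iso _ _) (iso_fmap _ (RU_shift_iso _)).
Qed.

Lemma pull_RU_shift_nat (A A' : H1 (sval V)) (x : hom A A') :
  pull_RU_shift A' ∘ fmap (pull H2 k) (fmap (RU V) (fmap (shift (tri H1 _)) x))
  = fmap (shift (tri H2 _)) (fmap (pull H2 k) (fmap (RU V) x)) ∘ pull_RU_shift A.
Proof. by rewrite !pull_RU_shiftE !composeA -pull_shift_nat !fmapMr -RU_shift_nat. Qed.

End PulledShift.

Section Theta.
Variables (S : B) (V W : U B) (k : @hom B S (sval V)) (a : @hom B (sval V) (sval W)).
Variables (h : @hom B S (sval W)) (e : h = a ∘ k).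

(** This is the image under [Phi] of the connection h^* A -> k^* a^* A, as [Phi_conn_eq] shows
    later. *)
Definition theta_over (A : H1 (sval W)) :
    hom (pull H2 h (RU W A)) (pull H2 k (RU V (pull H1 a A))) :=
  sval (sealed (fmap (pull H2 k) (theta_U a A) ∘ conn_eq e (RU W A))).

Lemma theta_overE A : theta_over A = fmap (pull H2 k) (theta_U a A) ∘ conn_eq e (RU W A).
Proof. exact: svalP (sealed _). Qed.

Lemma theta_over_iso A : is_iso (theta_over A).
Proof.
rewrite theta_overE; exact: iso_comp (iso_fmap _ (theta_U_iso _ _)) (conn_eq_iso _ _).
Qed.

Lemma theta_over_nat (A A' : H1 (sval W)) (x : hom A A') :
  theta_over A' ∘ fmap (pull H2 h) (fmap (RU W) x)
  = fmap (pull H2 k) (fmap (RU V) (fmap (pull H1 a) x)) ∘ theta_over A.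
Proof. by rewrite !theta_overE -composeA conn_eq_nat !composeA -!fmapM theta_U_nat. Qed.

Lemma theta_over_shift A :
  fmap (shift (tri H2 _)) (theta_over A) ∘ pull_RU_shift h A
  = pull_RU_shift k (pull H1 a A) ∘ fmap (pull H2 k) (fmap (RU V) (pull_shift a A))
    ∘ theta_over (shift (tri H1 _) A).
Proof.
rewrite !pull_RU_shiftE !theta_overE fmapM !composeA (comp23 (conn_eq_shift e _)).
rewrite (comp22 (conn_eq_nat e _)) -pull_shift_nat !fmapMr.
by rewrite -theta_U_shift composeA.
Qed.

End Theta.

Lemma theta_over_assoc (S : B) (V V0 W : U B) (k : @hom B S (sval V))
    (b : @hom B (sval V) (sval V0)) (a : @hom B (sval V0) (sval W))
    (m : @hom B S (sval V0)) (n : @hom B (sval V) (sval W)) (h : @hom B S (sval W))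
    (en : n = a ∘ b) (e1 : h = n ∘ k) (em : m = b ∘ k) (e2 : h = a ∘ m) A :
  theta_over em (pull H1 a A) ∘ theta_over e2 A
  = fmap (pull H2 k) (fmap (RU V) (conn_eq en A)) ∘ theta_over e1 A.
Proof.
rewrite !theta_overE !composeA -(composeA _ (conn_eq em _)) conn_eq_nat !composeA -!fmapM.
rewrite theta_U_cocycle !fmapM -!composeA; do 2!congr (_ ∘ _).
by rewrite (conn_eq_assoc en e1 em e2).
Qed.

Lemma theta_over_pull (T S : B) (V W : U B) (k : @hom B S (sval V))
    (a : @hom B (sval V) (sval W)) (h : @hom B S (sval W)) (e : h = a ∘ k)
    (f : hom T S) (h1 : @hom B T (sval W)) (k1 : @hom B T (sval V))
    (e1 : h1 = h ∘ f) (ek : k1 = k ∘ f) (e2 : h1 = a ∘ k1) A :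
  fmap (pull H2 f) (theta_over e A) ∘ conn_eq e1 (RU W A)
  = conn_eq ek (RU V (pull H1 a A)) ∘ theta_over e2 A.
Proof.
by rewrite !theta_overE fmapM -composeA (conn_eq_assoc e e1 ek e2) !composeA -(conn_eq_nat ek).
Qed.

(** * Fractions and the definition of [Phi] on morphisms *)

Section Lifts.
Variables (S : B) (W W' : U B).
Variables (h : @hom B S (sval W)) (A : H1 (sval W)).
Variables (h' : @hom B S (sval W')) (A' : H1 (sval W')).
Implicit Types (phi : hom (pull H1 h A) (pull H1 h' A')).
Implicit Types (psi : hom (pull H2 h (RU W A)) (pull H2 h' (RU W' A'))).

Section Roof.
Variables (V : U B) (k : @hom B S (sval V)).
Variables (a : @hom B (sval V) (sval W)) (b : @hom B (sval V) (sval W')).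
Variables (ea : h = a ∘ k) (eb : h' = b ∘ k).

(* The pair [(d, e)] presents [phi] as a fraction, [psi] being the fraction of its
   images. *)
Definition roof phi psi (D : H1 (sval V)) (d : hom (pull H1 a A) D)
    (e : hom (pull H1 b A') D) : Prop :=
  [/\ is_iso (fmap (pull H1 k) e), is_iso (fmap (pull H2 k) (fmap (RU V) e)),
      fmap (pull H1 k) e ∘ conn_eq eb A' ∘ phi = fmap (pull H1 k) d ∘ conn_eq ea A &
      fmap (pull H2 k) (fmap (RU V) e) ∘ theta_over eb A' ∘ psi
      = fmap (pull H2 k) (fmap (RU V) d) ∘ theta_over ea A].

Section Standard.
Variables (ks : functor (H1 S) (H1 (sval V))) (adj : adjunction (pull H1 k) ks).
Hypotheses (ck : closed k) (ff : fully_faithful ks).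

(** The numerator of [phi] over the universal denominator, the unit N -> k_* k^* N at N = b^* A'. *)
Definition std_map phi : hom (pull H1 a A) (ks (pull H1 k (pull H1 b A'))) :=
  transpose adj (conn_eq eb A' ∘ phi ∘ inv (conn_eq_iso ea A)).

Definition std_lift phi psi : Prop :=
  fmap (pull H2 k) (fmap (RU V) (adj_unit adj (pull H1 b A'))) ∘ theta_over eb A' ∘ psi
  = fmap (pull H2 k) (fmap (RU V) (std_map phi)) ∘ theta_over ea A.

Lemma unit_inverts (N : H1 (sval V)) :
  is_iso (fmap (pull H2 k) (fmap (RU V) (adj_unit adj N))).
Proof. exact: closed_inverts ck (fmap_unit_iso adj ff N). Qed.

Lemma std_roof phi psi :
  std_lift phi psi -> roof phi psi (std_map phi) (adj_unit adj (pull H1 b A')).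
Proof.
move=> E; split=> //; [exact: fmap_unit_iso | exact: unit_inverts |].
apply: (iso_mono (adj_counit_iso adj ff _)).
have K x : adj_counit adj (pull H1 k (pull H1 b A')) ∘ fmap (pull H1 k) (transpose adj x) = x.
  by apply: (transpose_inj (adj := adj)); rewrite transpose_counit.
by rewrite !composeA adj_triangleL compose1c /std_map K invlK.
Qed.

Lemma std_lift_ex phi : exists psi, std_lift phi psi.
Proof.
have i := iso_comp (unit_inverts (pull H1 b A')) (theta_over_iso eb A').
exists (inv i ∘ (fmap (pull H2 k) (fmap (RU V) (std_map phi)) ∘ theta_over ea A)).
by rewrite /std_lift composeA invr compose1c.
Qed.

Lemma std_lift_uniq phi psi psi' : std_lift phi psi -> std_lift phi psi' -> psi = psi'.
Proof.
rewrite /std_lift => <-; rewrite -!composeA.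
by move=> /(iso_mono (unit_inverts _)) /(iso_mono (theta_over_iso _ _)).
Qed.

(** The transpose [r] of the inverse of k^* e maps the given roof to the standard one: it takes [e]
    to the unit and [d] to [std_map phi]. *)
Lemma roof_std phi psi D (d : hom (pull H1 a A) D) (e : hom (pull H1 b A') D) :
  roof phi psi d e -> std_lift phi psi.
Proof.
case=> i _ E1 E2.
pose r := transpose adj (inv i).
have re : r ∘ e = adj_unit adj (pull H1 b A').
  by rewrite transpose_comp invl transpose_id.
have rd : r ∘ d = std_map phi.
  rewrite transpose_comp; congr transpose.
  by rewrite -[in LHS](invrK (conn_eq_iso ea A) (fmap _ d)) -E1 !composeA invl compose1c.
by rewrite /std_lift -re -rd !fmapM -!composeA -E2 !composeA.
Qed.

End Standard.
End Roof.

(** A relation quantifying over all roofs, so that [Phi], its functional form, may be computed on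
    whichever roof is convenient. *)
Variant lifts phi psi : Prop :=
  Lifts (V : U B) (k : @hom B S (sval V))
    (a : @hom B (sval V) (sval W)) (b : @hom B (sval V) (sval W'))
    (ea : h = a ∘ k) (eb : h' = b ∘ k) (D : H1 (sval V))
    (d : hom (pull H1 a A) D) (e : hom (pull H1 b A') D)
    of roof ea eb phi psi d e.

(** Roofs over different [V] become comparable after pulling them back to a common refinement. *)
Lemma roof_refine (V V' : U B) (k : @hom B S (sval V)) (k' : @hom B S (sval V'))
    (c : @hom B (sval V') (sval V)) (ek : k = c ∘ k')
    (a : @hom B (sval V) (sval W)) (b : @hom B (sval V) (sval W'))
    (a' : @hom B (sval V') (sval W)) (b' : @hom B (sval V') (sval W'))
    (ca : a' = a ∘ c) (cb : b' = b ∘ c)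
    (ea : h = a ∘ k) (eb : h' = b ∘ k) (ea' : h = a' ∘ k') (eb' : h' = b' ∘ k')
    phi psi D (d : hom (pull H1 a A) D) (e : hom (pull H1 b A') D) :
  roof ea eb phi psi d e ->
  roof ea' eb' phi psi
    (fmap (pull H1 c) d ∘ conn_eq ca A) (fmap (pull H1 c) e ∘ conn_eq cb A').
Proof.
case=> i1 i2 E1 E2; split.
- rewrite fmapM; apply: iso_comp; last exact: iso_fmap (conn_eq_iso _ _).
  apply: (iso_cancel_r (conn_eq_iso ek (pull H1 b A'))).
  by rewrite -conn_eq_nat; apply: iso_comp => //; apply: conn_eq_iso.
- rewrite !fmapM; apply: iso_comp; last by do 2!apply: iso_fmap; apply: conn_eq_iso.
  apply: (iso_cancel_r (theta_over_iso ek (pull H1 b A'))).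
  by rewrite -theta_over_nat; apply: iso_comp => //; apply: theta_over_iso.
- rewrite !fmapM -(composeA _ _ (conn_eq eb' A')) (conn_eq_assoc cb eb' ek eb) !composeA.
  rewrite -(composeA _ _ (conn_eq ea' A)) (conn_eq_assoc ca ea' ek ea) !composeA.
  by rewrite -!conn_eq_nat -!composeA -E1 !composeA.
- rewrite !fmapM -(composeA _ _ (theta_over eb' A')).
  rewrite -(theta_over_assoc cb eb' ek eb) !composeA.
  rewrite -(composeA _ _ (theta_over ea' A)) -(theta_over_assoc ca ea' ek ea) !composeA.
  by rewrite -!theta_over_nat -!composeA -E2 !composeA.
Qed.

(** Factoring (h, h') : S -> W × W' yields a closed immersion [k] lying over both [h] and [h'], and
    over [k] the standard roof exists. *)
Lemma lifts_ex phi : exists psi, lifts phi psi.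
Proof.
have [P [p [q pq]]] := U_product W W'.
have [hh [eh eh']] := product_pair pq h h'.
have [V [k [c [ck eV]]]] := closed_over hh.
have [ks [[adj] ff]] := localic_right_adj loc1 ck.
have ea : h = p ∘ c ∘ k by rewrite -composeA -eV.
have eb : h' = q ∘ c ∘ k by rewrite -composeA -eV.
have [psi std] := std_lift_ex ea eb adj ck ff phi.
exists psi; exact: Lifts (std_roof ck ff std).
Qed.

(* Any roof over [V] and the standard one over [Y * (W * W')] restrict to roofs
   over [Y * V], where [S] is still closed, hence they lift [phi] equally. *)
Lemma lifts_uniq phi psi psi' : lifts phi psi -> lifts phi psi' -> psi = psi'.
Proof.
have [Y [s cs]] := closed_embedding S.
have [P [p [q pq]]] := U_product W W'.
have [hh [eh eh']] := product_pair pq h h'.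
have [V0 [y0 [w0 yw0]]] := U_product Y P.
have [k0 [ey0 ew0]] := product_pair yw0 s hh.
have ck0 : closed k0 by apply: (@closed_cancel B _ _ _ k0 y0); rewrite ey0.
have ea0 : h = p ∘ w0 ∘ k0 by rewrite -composeA ew0.
have eb0 : h' = q ∘ w0 ∘ k0 by rewrite -composeA ew0.
have [ks0 [[adj0] ff0]] := localic_right_adj loc1 ck0.
have [psi0 std0] := std_lift_ex ea0 eb0 adj0 ck0 ff0 phi.
have roof0 := std_roof ck0 ff0 std0.
suff main u : lifts phi u -> u = psi0 by move=> /main -> /main ->.
case=> V k a b ea eb D d e r.
have [V' [y [v yv]]] := U_product Y V.
have [k' [ey ev]] := product_pair yv s k.
have ck' : closed k' by apply: (@closed_cancel B _ _ _ k' y); rewrite ey.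
have [ab [eA eB]] := product_pair pq a b.
(* [c0] = (y, (a, b) v) maps Y × V to Y × (W × W') under [S]; along it the standard roof is pulled
   back, while [r] is pulled back along [v]. *)
have [c0 [e1 e2]] := product_pair yw0 y (ab ∘ v).
have ek0 : k0 = c0 ∘ k'.
  apply: (product_inj yw0); first by rewrite composeA e1 ey ey0.
  rewrite composeA e2 -composeA ev ew0; apply: (product_inj pq).
    by rewrite composeA eA -ea.
  by rewrite composeA eB -eb.
have ca0 : a ∘ v = p ∘ w0 ∘ c0 by rewrite -composeA e2 composeA eA.
have cb0 : b ∘ v = q ∘ w0 ∘ c0 by rewrite -composeA e2 composeA eB.
have ea' : h = a ∘ v ∘ k' by rewrite -composeA ev.
have eb' : h' = b ∘ v ∘ k' by rewrite -composeA ev.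
have [ks [[adj] ff]] := localic_right_adj loc1 ck'.
have r1 := roof_refine (esym ev) (erefl (a ∘ v)) (erefl (b ∘ v)) ea' eb' r.
have r2 := roof_refine ek0 ca0 cb0 ea' eb' roof0.
exact: (std_lift_uniq ck' ff (roof_std adj r1) (roof_std adj r2)).
Qed.

Definition Phi phi : hom (pull H2 h (RU W A)) (pull H2 h' (RU W' A')) :=
  proj1_sig (constructive_indefinite_description _ (lifts_ex phi)).

Lemma PhiP phi : lifts phi (Phi phi).
Proof. exact: proj2_sig. Qed.

Lemma Phi_uniq phi psi : lifts phi psi -> Phi phi = psi.
Proof. exact: lifts_uniq (PhiP phi). Qed.

End Lifts.

(** * Functoriality of [Phi] and its compatibility with the structure maps *)

Lemma Phi_fmap (S : B) (W : U B) (h : @hom B S (sval W)) (A A' : H1 (sval W))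
    (x : hom A A') :
  Phi (fmap (pull H1 h) x) = fmap (pull H2 h) (fmap (RU W) x).
Proof.
have e : h = idc (sval W) ∘ h by rewrite compose1c.
apply: Phi_uniq.
apply: (@Lifts _ _ _ _ _ _ _ _ _ W h (idc _) (idc _) e e _
          (fmap (pull H1 (idc _)) x) (idc _)).
split; rewrite !fmap1; try exact: iso_id.
  by rewrite compose1c conn_eq_nat.
by rewrite compose1c theta_over_nat.
Qed.

Lemma Phi_id (S : B) (W : U B) (h : @hom B S (sval W)) (A : H1 (sval W)) :
  Phi (idc (pull H1 h A)) = idc (pull H2 h (RU W A)).
Proof. by rewrite -fmap1 Phi_fmap !fmap1. Qed.

(** All three morphisms receive standard roofs over a single [V], embedding [S] over W × W' × W''.
    There fractions compose by functoriality of [ks]. *)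
Lemma Phi_comp (S : B) (W W' W'' : U B)
    (h : @hom B S (sval W)) (A : H1 (sval W))
    (h' : @hom B S (sval W')) (A' : H1 (sval W'))
    (h'' : @hom B S (sval W'')) (A'' : H1 (sval W''))
    (x : hom (pull H1 h' A') (pull H1 h'' A'')) (y : hom (pull H1 h A) (pull H1 h' A')) :
  Phi (x ∘ y) = Phi x ∘ Phi y.
Proof.
have [P [p [q pq]]] := U_product W W'.
have [hh [eh eh']] := product_pair pq h h'.
have [Q [r [t rt]]] := U_product P W''.
have [hhh [ehh eh'']] := product_pair rt hh h''.
have [V [k [c [ck eV]]]] := closed_over hhh.
have [ks [[adj] ff]] := localic_right_adj loc1 ck.
have e1 : h = p ∘ r ∘ c ∘ k by rewrite -composeA -eV -composeA ehh.
have e2 : h' = q ∘ r ∘ c ∘ k by rewrite -composeA -eV -composeA ehh.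
have e3 : h'' = t ∘ c ∘ k by rewrite -composeA -eV.
have [psi std] := std_lift_ex e1 e2 adj ck ff y.
have [psi' std'] := std_lift_ex e2 e3 adj ck ff x.
rewrite (Phi_uniq (Lifts (std_roof ck ff std))) (Phi_uniq (Lifts (std_roof ck ff std'))).
apply/Phi_uniq/(@Lifts _ _ _ _ _ _ _ _ _ _ _ _ _ e1 e3)/(std_roof (adj := adj) ck ff).
rewrite /std_lift composeA std'.
have -> : std_map e1 e3 adj (x ∘ y)
    = fmap ks (conn_eq e3 A'' ∘ x ∘ inv (conn_eq_iso e2 A')) ∘ std_map e1 e2 adj y.
  by rewrite /std_map fmap_transpose !composeA invlK.
have -> : std_map e2 e3 adj x
    = fmap ks (conn_eq e3 A'' ∘ x ∘ inv (conn_eq_iso e2 A'))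
      ∘ adj_unit adj (pull H1 (q ∘ r ∘ c) A').
  by rewrite -transpose_id fmap_transpose composec1.
by rewrite !fmapM -!composeA [fmap _ (fmap _ (adj_unit _ _)) ∘ _]composeA std !composeA.
Qed.

Lemma Phi_iso (S : B) (W W' : U B)
    (h : @hom B S (sval W)) (A : H1 (sval W))
    (h' : @hom B S (sval W')) (A' : H1 (sval W'))
    (x : hom (pull H1 h A) (pull H1 h' A')) : is_iso x -> is_iso (Phi x).
Proof. by case=> y [yx xy]; exists (Phi y); rewrite -!Phi_comp yx xy !Phi_id. Qed.

(** The roof over [V] has an identity as denominator, and as numerator the connection of
    [a = a ∘ idc _]. *)
Lemma Phi_conn_eq (S : B) (V W : U B) (k : @hom B S (sval V)) (a : @hom B (sval V) (sval W))
    (h : @hom B S (sval W)) (e : h = a ∘ k) (A : H1 (sval W)) :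
  Phi (conn_eq e A) = theta_over e A.
Proof.
have ea : a = a ∘ idc _ by rewrite composec1.
have ek : k = idc _ ∘ k by rewrite compose1c.
apply: Phi_uniq.
apply: (@Lifts _ _ _ _ _ _ _ _ _ V k a (idc _) e ek _ (conn_eq ea A) (idc _)).
split; rewrite ?fmap1; try exact: iso_id.
  by rewrite compose1c (conn_eq_assoc ea e ek e).
by rewrite compose1c (theta_over_assoc ea e ek e).
Qed.

(** The hypothesis says that [y] is f^* x up to connections. A roof of [x] over [k] is then a roof
    of [y] over [k ∘ f], with the same numerator and denominator. *)
Lemma Phi_pull (T S : B) (f : hom T S) (W W' : U B)
    (h : @hom B S (sval W)) (A : H1 (sval W))
    (h' : @hom B S (sval W')) (A' : H1 (sval W'))
    (h1 : @hom B T (sval W)) (e : h1 = h ∘ f)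
    (h1' : @hom B T (sval W')) (e' : h1' = h' ∘ f)
    (x : hom (pull H1 h A) (pull H1 h' A')) (y : hom (pull H1 h1 A) (pull H1 h1' A')) :
  conn_eq e' A' ∘ y = fmap (pull H1 f) x ∘ conn_eq e A ->
  conn_eq e' (RU W' A') ∘ Phi y = fmap (pull H2 f) (Phi x) ∘ conn_eq e (RU W A).
Proof.
move=> E; apply: (iso_mono (iso_inv (conn_eq_iso e' _))).
rewrite composeA invl compose1c; apply: Phi_uniq.
case: (PhiP x) => V k a b ea eb D d d' [i1 i2 E1 E2].
have ea1 : h1 = a ∘ (k ∘ f) by rewrite composeA -ea.
have eb1 : h1' = b ∘ (k ∘ f) by rewrite composeA -eb.
apply: (@Lifts _ _ _ _ _ _ _ _ _ V (k ∘ f) a b ea1 eb1 D d d').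
have ek : k ∘ f = k ∘ f by [].
split.
- apply: (iso_cancel_l (conn_eq_iso ek D)); rewrite conn_eq_nat.
  by apply: iso_comp (conn_eq_iso _ _); apply: iso_fmap.
- apply: (iso_cancel_l (conn_eq_iso ek _)); rewrite conn_eq_nat.
  by apply: iso_comp (conn_eq_iso _ _); apply: iso_fmap.
- apply: (iso_mono (conn_eq_iso ek D)); rewrite !composeA !conn_eq_nat.
  rewrite -!(composeA _ (conn_eq ek _)).
  rewrite -(conn_eq_assoc eb e' ek eb1) -(conn_eq_assoc ea e ek ea1).
  rewrite !composeA -(composeA _ (conn_eq e' A')) E !composeA -!fmapM.
  by rewrite E1.
- apply: (iso_mono (conn_eq_iso ek _)); rewrite !composeA !conn_eq_nat.
  rewrite -!(composeA _ (conn_eq ek _)).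
  rewrite -(theta_over_pull eb e' ek eb1) -(theta_over_pull ea e ek ea1).
  rewrite !composeA invrK -!fmapM.
  by rewrite E2.
Qed.

(** Here [y] is the shift of [x]; shifting the numerator and the denominator of a roof of [x] gives
    a roof of [y]. *)
Lemma Phi_shift (S : B) (W W' : U B)
    (h : @hom B S (sval W)) (A : H1 (sval W))
    (h' : @hom B S (sval W')) (A' : H1 (sval W'))
    (x : hom (pull H1 h A) (pull H1 h' A'))
    (y : hom (pull H1 h (shift (tri H1 _) A)) (pull H1 h' (shift (tri H1 _) A'))) :
  pull_shift h' A' ∘ y = fmap (shift (tri H1 _)) x ∘ pull_shift h A ->
  pull_RU_shift h' A' ∘ Phi y = fmap (shift (tri H2 _)) (Phi x) ∘ pull_RU_shift h A.
Proof.
move=> E; apply: (iso_mono (iso_inv (pull_RU_shift_iso h' A'))).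
rewrite composeA invl compose1c; apply: Phi_uniq.
case: (PhiP x) => V k a b ea eb D d e [i1 i2 E1 E2].
apply: (@Lifts _ _ _ _ _ _ _ _ _ V k a b ea eb (shift (tri H1 _) D)
  (fmap (shift (tri H1 _)) d ∘ pull_shift a A) (fmap (shift (tri H1 _)) e ∘ pull_shift b A')).
split.
- rewrite fmapM; apply: iso_comp; last exact: iso_fmap (pull_shift_iso _ _).
  apply: (iso_cancel_l (pull_shift_iso k D)); rewrite pull_shift_nat.
  exact: iso_comp (iso_fmap _ i1) (pull_shift_iso _ _).
- rewrite !fmapM; apply: iso_comp; last by do 2!apply: iso_fmap; apply: pull_shift_iso.
  apply: (iso_cancel_l (pull_RU_shift_iso k D)); rewrite pull_RU_shift_nat.
  exact: iso_comp (iso_fmap _ i2) (pull_RU_shift_iso _ _).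
- apply: (iso_mono (pull_shift_iso k D)); rewrite !fmapM !composeA !pull_shift_nat.
  rewrite -!(comp23 (conn_eq_shift _ _)) (comp22 E) -!fmapM.
  by rewrite E1.
- apply: (iso_mono (pull_RU_shift_iso k D)); rewrite !fmapM !composeA !pull_RU_shift_nat.
  rewrite -!(comp23 (theta_over_shift _ _)) invrK -!fmapM.
  by rewrite E2.
Qed.

Lemma pull_RU_shift_pull (T S : B) (f : hom T S) (W : U B) (h : @hom B S (sval W))
    (h1 : @hom B T (sval W)) (e : h1 = h ∘ f) (A : H1 (sval W)) :
  pull_shift f (pull H2 h (RU W A)) ∘ fmap (pull H2 f) (pull_RU_shift h A)
    ∘ conn_eq e (RU W (shift (tri H1 _) A))
  = fmap (shift (tri H2 _)) (conn_eq e (RU W A)) ∘ pull_RU_shift h1 A.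
Proof.
by rewrite !pull_RU_shiftE fmapM !composeA conn_eq_shift -(comp22 (conn_eq_nat _ _)).
Qed.

(* A value at [S] for the extended morphism, identified with [Phi] along
   presentations [(mW, mh, mA A)] of the objects [A]. *)
Record model (S : B) := Model {
  mF :> functor (H1 S) (H2 S);
  mT : tri_functor (tri H1 S) (tri H2 S) mF;
  mW : U B;
  mh : @hom B S (sval mW);
  mA : H1 S -> H1 (sval mW);
  meps : forall A, hom (pull H1 mh (mA A)) A;
  meps_iso : forall A, is_iso (meps A);
  mom : forall A, hom (pull H2 mh (RU mW (mA A))) (mF A);
  mom_iso : forall A, is_iso (mom A);
  m_nat : forall (A A' : H1 S) (x : hom A A')
      (y : hom (pull H1 mh (mA A)) (pull H1 mh (mA A'))),
    meps A' ∘ y = x ∘ meps A -> fmap mF x ∘ mom A = mom A' ∘ Phi y;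
  m_shift : forall (A : H1 S)
      (y : hom (pull H1 mh (mA (shift (tri H1 S) A)))
               (pull H1 mh (shift (tri H1 _) (mA A)))),
    fmap (shift (tri H1 S)) (meps A) ∘ pull_shift mh (mA A) ∘ y = meps (shift (tri H1 S) A) ->
    tf_shift mT A ∘ mom (shift (tri H1 S) A)
    = fmap (shift (tri H2 S)) (mom A) ∘ pull_RU_shift mh (mA A) ∘ Phi y
}.

(** * The isomorphisms [theta] between two models *)

Section ModelTheta.
Variables (S T : B) (M : model S) (N : model T) (f : hom T S).

(** Over [T] the object f^* A has two presentations, that of [M] pulled back along [f] and that of
    [N]. This compares them, and its [Phi] becomes [theta]. *)
Definition model_cmp (A : H1 S) :
    hom (pull H1 (mh M ∘ f) (mA M A)) (pull H1 (mh N) (mA N (pull H1 f A))) :=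
  sval (sealed (inv (meps_iso N (pull H1 f A))
    ∘ (fmap (pull H1 f) (meps M A) ∘ conn_eq (erefl (mh M ∘ f)) (mA M A)))).

Lemma model_cmpE A :
  model_cmp A = inv (meps_iso N (pull H1 f A))
    ∘ (fmap (pull H1 f) (meps M A) ∘ conn_eq (erefl (mh M ∘ f)) (mA M A)).
Proof. exact: svalP (sealed _). Qed.

Lemma model_cmpP A :
  meps N (pull H1 f A) ∘ model_cmp A
  = fmap (pull H1 f) (meps M A) ∘ conn_eq (erefl (mh M ∘ f)) (mA M A).
Proof. by rewrite model_cmpE composeA invr compose1c. Qed.

Definition model_src (A : H1 S) :
    hom (pull H2 (mh M ∘ f) (RU (mW M) (mA M A))) (pull H2 f (M A)) :=
  fmap (pull H2 f) (mom M A) ∘ conn_eq (erefl (mh M ∘ f)) _.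

Lemma model_src_iso A : is_iso (model_src A).
Proof. exact: iso_comp (iso_fmap _ (mom_iso M A)) (conn_eq_iso _ _). Qed.

Definition model_theta_at (A : H1 S) : hom (pull H2 f (M A)) (N (pull H1 f A)) :=
  sval (sealed (mom N (pull H1 f A) ∘ Phi (model_cmp A) ∘ inv (model_src_iso A))).

Lemma model_theta_atE A :
  model_theta_at A = mom N (pull H1 f A) ∘ Phi (model_cmp A) ∘ inv (model_src_iso A).
Proof. exact: svalP (sealed _). Qed.

Lemma model_theta_atP A :
  model_theta_at A ∘ fmap (pull H2 f) (mom M A) ∘ conn_eq (erefl (mh M ∘ f)) _
  = mom N (pull H1 f A) ∘ Phi (model_cmp A).
Proof. by rewrite -composeA model_theta_atE invlK. Qed.

Lemma model_cmp_iso A : is_iso (model_cmp A).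
Proof.
rewrite model_cmpE; apply: iso_comp (iso_inv _) _.
exact: iso_comp (iso_fmap _ (meps_iso _ _)) (conn_eq_iso _ _).
Qed.

Lemma model_theta_at_iso A : is_iso (model_theta_at A).
Proof.
rewrite model_theta_atE; apply: iso_comp (iso_inv _).
exact: iso_comp (mom_iso _ _) (Phi_iso (model_cmp_iso _)).
Qed.

(** The pattern of all coherence proofs for models: [iso_solve] lifts each structure map to the
    presentations, [Phi_comp] collects the images, and what remains is an identity in [H1], checked
    after composing with the invertible [meps]. *)
Lemma model_theta_at_nat (A A' : H1 S) (x : hom A A') :
  model_theta_at A' ∘ fmap (pull H2 f) (fmap M x)
  = fmap N (fmap (pull H1 f) x) ∘ model_theta_at A.
Proof.
have [y ey] := iso_solve (x ∘ meps M A) (meps_iso M A').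
have [y1 ey1] := iso_solve (fmap (pull H1 f) y ∘ conn_eq (erefl (mh M ∘ f)) (mA M A))
  (conn_eq_iso (erefl (mh M ∘ f)) (mA M A')).
have [y2 ey2] := iso_solve (fmap (pull H1 f) x ∘ meps N (pull H1 f A))
  (meps_iso N (pull H1 f A')).
apply: (iso_epi (model_src_iso A)); rewrite /model_src !composeA.
rewrite fmapMr (m_nat ey) fmapM composeA -(comp22 (Phi_pull ey1)).
rewrite model_theta_atP (comp32 (model_theta_atP A)) (m_nat ey2) -!composeA -!Phi_comp.
congr (_ ∘ Phi _).
apply: (iso_mono (meps_iso N _)); rewrite !composeA model_cmpP ey2 -!composeA.
by rewrite model_cmpP ey1 !composeA -!fmapM ey.
Qed.

Definition model_theta : nat_iso (fcomp (pull H2 f) M) (fcomp N (pull H1 f)) :=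
  nat_iso_of (t := @NatTrans _ _ (fcomp (pull H2 f) M) (fcomp N (pull H1 f))
                     model_theta_at model_theta_at_nat) model_theta_at_iso.

Lemma model_theta_tri :
  triangulated_trans (shift_comm_comp (tri_pull H2 f) (mT M))
    (shift_comm_comp (mT N) (tri_pull H1 f)) model_theta.
Proof.
move=> A.
change (tf_shift (mT N) (pull H1 f A) ∘ fmap N (pull_shift f A)
    ∘ model_theta_at (shift (tri H1 S) A)
  = fmap (shift (tri H2 T)) (model_theta_at A)
    ∘ (pull_shift f (M A) ∘ fmap (pull H2 f) (tf_shift (mT M) A))).
(* On presentations, [y1] is the shift isomorphism of f^*, [y2] and [y3] compare shifts in [N] and
   in [M], [y4] is f^* of [y3], and [y5] is the shift of [model_cmp]. *)
have [y1 ey1] := iso_solve (pull_shift f A ∘ meps N (pull H1 f (shift (tri H1 S) A)))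
  (meps_iso N (shift (tri H1 T) (pull H1 f A))).
have iN := iso_comp (iso_fmap (shift (tri H1 T)) (meps_iso N (pull H1 f A)))
  (pull_shift_iso (mh N) (mA N (pull H1 f A))).
have [y2 ey2] := iso_solve (meps N (shift (tri H1 T) (pull H1 f A))) iN.
have iM := iso_comp (iso_fmap (shift (tri H1 S)) (meps_iso M A))
  (pull_shift_iso (mh M) (mA M A)).
have [y3 ey3] := iso_solve (meps M (shift (tri H1 S) A)) iM.
have [y4 ey4] := iso_solve
  (fmap (pull H1 f) y3 ∘ conn_eq (erefl (mh M ∘ f)) (mA M (shift (tri H1 S) A)))
  (conn_eq_iso (erefl (mh M ∘ f)) (shift (tri H1 _) (mA M A))).
have [y5 ey5] := iso_solve
  (fmap (shift (tri H1 T)) (model_cmp A) ∘ pull_shift (mh M ∘ f) (mA M A))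
  (pull_shift_iso (mh N) (mA N (pull H1 f A))).
apply: (iso_epi (model_src_iso (shift (tri H1 S) A))); rewrite /model_src !composeA.
rewrite (comp32 (model_theta_atP _)) (comp22 (m_nat ey1)) (m_shift ey2).
rewrite fmapMr (m_shift ey3) !fmapM !composeA.
rewrite -(comp22 (Phi_pull ey4)) (comp22 (pull_shift_nat f (mom M A))).
rewrite (comp32 (pull_RU_shift_pull (erefl (mh M ∘ f)) (mA M A))).
rewrite -!fmapM model_theta_atP fmapM -(comp22 (Phi_shift ey5)).
rewrite -!composeA -!Phi_comp; do 2!congr (_ ∘ _); congr Phi.
apply: (iso_mono iN).
rewrite !composeA ey2 ey1 -(composeA (pull_shift f A)) model_cmpP.
rewrite (comp22 ey5) -fmapM model_cmpP fmapM (comp23 (conn_eq_shift _ _)) (comp22 ey4).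
rewrite -(pull_shift_nat f (meps M A)) !fmapMr -ey3.
by rewrite !composeA.
Qed.

End ModelTheta.

Lemma model_theta_at_comp (T S V : B) (L : model V) (M : model S) (N : model T)
    (f : hom T S) (g : hom S V) (m : hom T V) (e : m = g ∘ f) (A : H1 V) :
  fmap N (conn_eq e A) ∘ model_theta_at L N m A
  = model_theta_at M N f (pull H1 g A) ∘ fmap (pull H2 f) (model_theta_at L M g A)
    ∘ conn_eq e (L A).
Proof.
have e1 : mh L ∘ m = (mh L ∘ g) ∘ f by rewrite e composeA.
have [y ey] := iso_solve (conn_eq e A ∘ meps N (pull H1 m A))
  (meps_iso N (pull H1 f (pull H1 g A))).
have [y1 ey1] := iso_solve (fmap (pull H1 f) (model_cmp L M g A) ∘ conn_eq e1 (mA L A))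
  (conn_eq_iso (erefl (mh M ∘ f)) (mA M (pull H1 g A))).
apply: (iso_epi (model_src_iso L m A)); rewrite /model_src !composeA.
rewrite (comp32 (model_theta_atP L N m A)) (m_nat ey).
rewrite (comp22 (conn_eq_nat e (mom L A))).
rewrite -(comp22 (conn_eq_assoc (erefl (mh L ∘ g)) e1 e (erefl (mh L ∘ m)) _)).
rewrite !fmapMr !composeA model_theta_atP fmapM composeA -(comp22 (Phi_pull ey1)).
rewrite model_theta_atP.
rewrite -!composeA -!Phi_comp; congr (_ ∘ _); congr Phi.
apply: (iso_mono (meps_iso N _)); rewrite !composeA ey -composeA !model_cmpP.
rewrite -composeA ey1 !composeA -fmapM model_cmpP fmapM conn_eq_nat.
by rewrite -!composeA (conn_eq_assoc (erefl (mh L ∘ g)) e1 e (erefl (mh L ∘ m))).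
Qed.

Lemma model_theta_cocycle (T S V : B) (L : model V) (M : model S) (N : model T)
    (f : hom T S) (g : hom S V) (A : H1 V) :
  fmap N (conn H1 f g A) ∘ model_theta L N (g ∘ f) A
  = model_theta M N f (pull H1 g A) ∘ fmap (pull H2 f) (model_theta L M g A)
    ∘ conn H2 f g (L A).
Proof. rewrite -!conn_eq_conn; exact: model_theta_at_comp. Qed.

Definition extend (M : forall S, model S) : tri_mor H1 H2 :=
  @TriMor B H1 H2
    (@FibMor B H1 H2 (fun S => M S) (fun T S f => model_theta (M S) (M T) f)
      (fun T S V f g A => model_theta_cocycle (M V) (M S) (M T) f g A))
    (fun S => mT (M S))
    (fun T S f => model_theta_tri (M S) (M T) f).

(** Depends on the family of models over [U] alone. The restriction of [extend] is convertible to
    it, so an equality of families can be rewritten without transporting fields. *)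
Definition extendU (M : forall X : U B, model (sval X)) :
    tri_mor (restr_tri (@inU B) H1) (restr_tri (@inU B) H2) :=
  @TriMor (U B) (restr_tri (@inU B) H1) (restr_tri (@inU B) H2)
    (@FibMor (U B) (restr_tri (@inU B) H1) (restr_tri (@inU B) H2)
      (fun X => M X) (fun T S f => model_theta (M S) (M T) f)
      (fun T S V f g A => model_theta_cocycle (M V) (M S) (M T) f g A))
    (fun X => mT (M X))
    (fun T S f => model_theta_tri (M S) (M T) f).

Lemma restr_extend (M : forall S, model S) :
  restr_mor (@inU B) (extend M) = extendU (fun X => M (sval X)).
Proof. by []. Qed.

(** * The model given by [R] itself over an object of [U] *)

Section SmoothModel.
Variable X : U B.
Let S : B := sval X.

Lemma U_model_nat (A A' : H1 S) (x : hom A A')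
    (y : hom (pull H1 (idc S) A) (pull H1 (idc S) A')) :
  inv (id_pull_iso A') ∘ y = x ∘ inv (id_pull_iso A) ->
  fmap (RU X) x ∘ inv (id_pull_iso (RU X A))
  = inv (id_pull_iso (RU X A')) ∘ Phi (W := X) (W' := X) y.
Proof.
move=> E; have -> : y = fmap (pull H1 (idc S)) x.
  by apply: (iso_mono (iso_inv (id_pull_iso A'))); rewrite E inv_id_pull_nat.
by rewrite Phi_fmap inv_id_pull_nat.
Qed.

Lemma U_model_shift (A : H1 S)
    (y : hom (pull H1 (idc S) (shift (tri H1 S) A)) (pull H1 (idc S) (shift (tri H1 S) A))) :
  fmap (shift (tri H1 S)) (inv (id_pull_iso A)) ∘ pull_shift (idc S) A ∘ y
    = inv (id_pull_iso (shift (tri H1 S) A)) ->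
  RU_shift A ∘ inv (id_pull_iso (RU X (shift (tri H1 S) A)))
  = fmap (shift (tri H2 S)) (inv (id_pull_iso (RU X A))) ∘ pull_RU_shift (V := X) (idc S) A
    ∘ Phi (W := X) (W' := X) y.
Proof.
rewrite inv_id_pull_shift -[RHS]composec1 => /(iso_mono (iso_inv (id_pull_iso _))) ->.
by rewrite Phi_id composec1 pull_RU_shiftE composeA inv_id_pull_shift inv_id_pull_nat.
Qed.

Definition U_model : model S :=
  @Model S (RU X) (tri_mor_at R X) X (idc S) (fun A => A)
    (fun A => inv (id_pull_iso A)) (fun A => iso_inv (id_pull_iso A))
    (fun A => inv (id_pull_iso (RU X A))) (fun A => iso_inv (id_pull_iso (RU X A)))
    U_model_nat U_model_shift.

End SmoothModel.

(** Here [model_cmp] is the connection of [idc _ ∘ f = f ∘ idc _], so [Phi_conn_eq] returns the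
    original [theta_U]; this makes the restriction equal to [R]. *)
Lemma U_model_theta (T S : U B) (f : @hom B (sval T) (sval S)) (A : H1 (sval S)) :
  model_theta_at (U_model S) (U_model T) f A = theta_U f A.
Proof.
apply: (iso_epi (model_src_iso (U_model S) f A)).
rewrite /model_src composeA model_theta_atP /=.
have e : idc _ ∘ f = f ∘ idc _ by rewrite compose1c composec1.
have e0 : idc _ ∘ f = f by rewrite compose1c.
have -> : model_cmp (U_model S) (U_model T) f A = conn_eq e A.
  apply: (iso_mono (iso_inv (id_pull_iso (pull H1 f A)))).
  by rewrite (model_cmpP (U_model S) (U_model T) f A) /= (id_pull_conn_eq e0 _ e).
rewrite Phi_conn_eq theta_overE composeA inv_id_pull_nat -!composeA; congr (_ ∘ _).
by rewrite (id_pull_conn_eq e0 _ e).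
Qed.

(** * The model given by a closed embedding into an object of [U] *)

Section ClosedModel.
Variables (S : B) (Y : U B) (s : @hom B S (sval Y)).
Variables (ss : functor (H1 S) (H1 (sval Y))) (adj : adjunction (pull H1 s) ss).
Hypothesis ff : fully_faithful ss.
Let sh1 : functor (H1 S) (H1 S) := shift (tri H1 S).
Let eps := adj_counit adj.
Let epsI : forall A, is_iso (eps A) := adj_counit_iso adj ff.

Definition closed_fun : functor (H1 S) (H2 S) := fcomp (pull H2 s) (fcomp (RU Y) ss).

Lemma closed_fmap (A A' : H1 S) (x : hom A A') :
  fmap closed_fun x = Phi (fmap (pull H1 s) (fmap ss x)).
Proof. by rewrite Phi_fmap. Qed.

(** The functor [ss] comes without a shift isomorphism. After s^* both sides are identified with
    A[1], and [Phi] needs the comparison only there. *)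
Definition closed_cmp (A : H1 S) :
    hom (pull H1 s (ss (sh1 A))) (pull H1 s (shift (tri H1 _) (ss A))) :=
  sval (sealed (inv (pull_shift_iso s (ss A)) ∘ (inv (iso_fmap sh1 (epsI A)) ∘ eps (sh1 A)))).

Lemma closed_cmpE A :
  closed_cmp A = inv (pull_shift_iso s (ss A)) ∘ (inv (iso_fmap sh1 (epsI A)) ∘ eps (sh1 A)).
Proof. exact: svalP (sealed _). Qed.

Lemma closed_cmpP A : fmap sh1 (eps A) ∘ pull_shift s (ss A) ∘ closed_cmp A = eps (sh1 A).
Proof. by rewrite closed_cmpE !composeA invrK invr compose1c. Qed.

Lemma closed_cmp_uniq A x :
  fmap sh1 (eps A) ∘ pull_shift s (ss A) ∘ x = eps (sh1 A) -> x = closed_cmp A.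
Proof.
rewrite -closed_cmpP => /iso_mono; apply.
exact: iso_comp (iso_fmap sh1 (epsI A)) (pull_shift_iso _ _).
Qed.

Definition closed_shift (A : H1 S) :
    hom (closed_fun (sh1 A)) (shift (tri H2 S) (closed_fun A)) :=
  sval (sealed (pull_RU_shift s (ss A) ∘ Phi (closed_cmp A))).

Lemma closed_shiftE A : closed_shift A = pull_RU_shift s (ss A) ∘ Phi (closed_cmp A).
Proof. exact: svalP (sealed _). Qed.

Lemma closed_shift_iso A : is_iso (closed_shift A).
Proof.
rewrite closed_shiftE; apply: iso_comp (pull_RU_shift_iso _ _) (Phi_iso _).
rewrite closed_cmpE; apply: iso_comp (iso_inv _) _.
exact: iso_comp (iso_inv _) (epsI _).
Qed.

Lemma closed_shift_nat (A A' : H1 S) (x : hom A A') :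
  closed_shift A' ∘ fmap closed_fun (fmap sh1 x)
  = fmap (shift (tri H2 S)) (fmap closed_fun x) ∘ closed_shift A.
Proof.
rewrite !closed_shiftE composeA -pull_RU_shift_nat -!composeA closed_fmap -Phi_fmap -!Phi_comp.
congr (_ ∘ Phi _).
have i := iso_comp (iso_fmap sh1 (epsI A')) (pull_shift_iso s (ss A')).
apply: (iso_mono i); rewrite !composeA closed_cmpP adj_counit_nat.
rewrite -(composeA _ (pull_shift s _)) pull_shift_nat composeA -fmapM adj_counit_nat fmapM.
by rewrite -[adj_counit adj (sh1 A)]closed_cmpP !composeA.
Qed.

Definition closed_shift_ni :
    nat_iso (fcomp closed_fun sh1) (fcomp (shift (tri H2 S)) closed_fun) :=
  nat_iso_of (t := @NatTrans _ _ (fcomp closed_fun sh1)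
      (fcomp (shift (tri H2 S)) closed_fun) closed_shift closed_shift_nat)
    closed_shift_iso.

Lemma closed_additive : additive_functor (tri H1 S) (tri H2 S) closed_fun.
Proof.
move=> A A' x y /=.
rewrite (additive_right_adjoint adj (tf_additive (tri_pull H1 s))).
rewrite (tf_additive (tri_mor_at R Y)).
exact: (tf_additive (tri_pull H2 s)).
Qed.

(* Every triangle of [H1 S] is the pullback of a triangle of [H1 Y]. *)
Lemma closed_dist (X1 X2 X3 : H1 S) (f : hom X1 X2) (g : hom X2 X3)
    (h : hom X3 (sh1 X1)) :
  dist f g h ->
  dist (fmap closed_fun f) (fmap closed_fun g) (closed_shift X1 ∘ fmap closed_fun h).
Proof.
move=> t; have [C [g' [h' t']]] := TR1_cone (tri H1 _) (fmap ss f).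
have t1 := tf_dist (tri_pull H1 s) t'.
have ef : eps X2 ∘ fmap (pull H1 s) (fmap ss f) = f ∘ eps X1 by apply: adj_counit_nat.
have [k [kg kh]] := TR3 t1 t ef.
have ik := five_lemma t1 t (epsI X1) (epsI X2) ef kg kh.
(* [y] is [k] read on presentations; [Phi y] is the third component of an isomorphism from the image
   of [t'] to the required triangle. *)
have [y ey] := iso_solve k (epsI X3).
have iy : is_iso y by apply: (iso_cancel_l (epsI X3)); rewrite ey.
have t2 := tf_dist (tri_pull H2 s) (tf_dist (tri_mor_at R Y) t').
apply: (TR1_iso (iso_id _) (iso_id _) (Phi_iso iy) _ _ _ t2).
- by rewrite compose1c composec1.
- rewrite composec1 closed_fmap -Phi_fmap -Phi_comp; congr Phi.
  apply: (iso_mono (epsI X3)); rewrite composeA ey kg.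
  by rewrite adj_counit_nat.
- rewrite fmap1 compose1c closed_shiftE closed_fmap.
  transitivity (pull_RU_shift s (ss X1) ∘ Phi (fmap (pull H1 s) h')).
    by rewrite pull_RU_shiftE Phi_fmap -composeA -fmapM.
  rewrite -!composeA -!Phi_comp; congr (_ ∘ Phi _).
  have i := iso_comp (iso_fmap sh1 (epsI X1)) (pull_shift_iso s (ss X1)).
  apply: (iso_mono i); rewrite !composeA closed_cmpP.
  rewrite adj_counit_nat -(composeA h) ey.
  by rewrite -composeA kh.
Qed.

Definition closed_tri : tri_functor (tri H1 S) (tri H2 S) closed_fun :=
  @TriFunctor _ _ _ _ closed_fun closed_shift_ni closed_additive closed_dist.

Lemma closed_model_nat (A A' : H1 S) (x : hom A A')
    (y : hom (pull H1 s (ss A)) (pull H1 s (ss A'))) :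
  eps A' ∘ y = x ∘ eps A ->
  fmap closed_fun x ∘ idc _ = idc _ ∘ Phi y.
Proof.
move=> E; rewrite compose1c composec1 closed_fmap; congr Phi.
by apply: (iso_mono (epsI A')); rewrite E adj_counit_nat.
Qed.

Lemma closed_model_shift (A : H1 S)
    (y : hom (pull H1 s (ss (sh1 A))) (pull H1 s (shift (tri H1 _) (ss A)))) :
  fmap sh1 (eps A) ∘ pull_shift s (ss A) ∘ y = eps (sh1 A) ->
  tf_shift closed_tri A ∘ idc _
  = fmap (shift (tri H2 S)) (idc (closed_fun A)) ∘ pull_RU_shift s (ss A) ∘ Phi y.
Proof.
by move=> /closed_cmp_uniq ->; rewrite fmap1 compose1c composec1 -closed_shiftE.
Qed.

Definition closed_model : model S :=
  @Model S closed_fun closed_tri Y s ss eps epsI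
    (fun A => idc _) (fun A => iso_id _) closed_model_nat closed_model_shift.

End ClosedModel.

(** * Choice of models and existence *)

Lemma model_inhabited (S : B) : inhabited (model S).
Proof.
have [Y [s cs]] := closed_embedding S.
have [ss [[adj] ff]] := localic_right_adj loc1 cs.
exact: inhabits (closed_model adj ff).
Qed.

(* On [U] the extension has to equal [R] and not only be isomorphic to it. *)
Definition choose_model (S : B) : model S :=
  match excluded_middle_informative (inU S) with
  | left h => U_model (exist _ S h)
  | right _ => epsilon (model_inhabited S) (fun _ => True)
  end.

Lemma choose_U_model (X : U B) : choose_model (sval X) = U_model X.
Proof.
case: X => S h; rewrite /choose_model /=.
by case: excluded_middle_informative => // h'; rewrite (proof_irrelevance _ h h').
Qed.

Lemma extension_exists : exists Rt : tri_mor H1 H2, restr_mor (@inU B) Rt = R.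
Proof.
exists (extend choose_model); rewrite restr_extend.
have -> : (fun X : U B => choose_model (sval X)) = U_model.
  by apply: functional_extensionality_dep => X; apply: choose_U_model.
apply: tri_mor_eq => T S f; apply: nat_iso_eq => A; exact: U_model_theta.
Qed.

End Extension.

(** * Uniqueness of the extension *)

Section FiberedMorphisms.
Variables (C : category) (H1 H2 : fibered C) (P : fib_mor H1 H2).

Lemma theta_nat (T S : C) (f : hom T S) (A A' : H1 S) (x : hom A A') :
  theta P f A' ∘ fmap (pull H2 f) (fmap (P S) x)
  = fmap (P T) (fmap (pull H1 f) x) ∘ theta P f A.
Proof. exact: (nt_natural (theta P f) x). Qed.

Lemma theta_iso (T S : C) (f : hom T S) (A : H1 S) : is_iso (theta P f A).
Proof. exact: (ni_iso (theta P f)). Qed.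

Lemma theta_conn_eq (S V W : C) (k : hom S V) (a : hom V W) (h : hom S W)
    (e : h = a ∘ k) (A : H1 W) :
  fmap (P S) (conn_eq e A) ∘ theta P h A
  = theta P k (pull H1 a A) ∘ fmap (pull H2 k) (theta P a A) ∘ conn_eq e (P W A).
Proof. subst h; rewrite !conn_eq_conn; exact: (theta_cocycle P k a A). Qed.

End FiberedMorphisms.

Lemma mor2_eq (C : category) (H1 H2 : fibered C) (P Q : fib_mor H1 H2)
    (g g' : mor2 P Q) : (forall S A, g S A = g' S A) -> g = g'.
Proof.
case: g g' => [g p] [g' p'] /= E.
have Eg : g = g' by apply: functional_extensionality_dep => S; apply: nat_trans_eq.
by subst g'; rewrite (proof_irrelevance _ p p').
Qed.

Lemma m2_nat (C : category) (H1 H2 : fibered C) (P Q : fib_mor H1 H2)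
    (g : mor2 P Q) (S : C) (A A' : H1 S) (x : hom A A') :
  g S A' ∘ fmap (P S) x = fmap (Q S) x ∘ g S A.
Proof. exact: nt_natural. Qed.

Lemma mor2_of_eq_iso (C : category) (H1 H2 : tri_fibered C) (R R' : tri_mor H1 H2)
    (e : R = R') : is_2iso (mor2_of_eq e).
Proof. by case: R' / e => S A; apply: iso_id. Qed.

Section Uniqueness.
Variables (B : base) (H1 H2 : tri_fibered B).
Hypothesis loc1 : localic H1.
Variables (P Q : fib_mor H1 H2).
Variable g0 : mor2 (restr_fib_mor (@inU B) P) (restr_fib_mor (@inU B) Q).

Definition gU (W : U B) (N : H1 (sval W)) : hom (P (sval W) N) (Q (sval W) N) :=
  g0 W N.

Lemma gU_nat (W : U B) (N N' : H1 (sval W)) (x : hom N N') :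
  gU N' ∘ fmap (P _) x = fmap (Q _) x ∘ gU N.
Proof. exact: (nt_natural (g0 W) x). Qed.

Lemma gU_theta (V W : U B) (a : @hom B (sval V) (sval W)) (N : H1 (sval W)) :
  theta Q a N ∘ fmap (pull H2 a) (gU N) = gU (W := V) (pull H1 a N) ∘ theta P a N.
Proof. exact: (@m2_theta _ _ _ _ _ g0 V W a N). Qed.

(** The condition [m2_theta] at [h], with the component over [W] prescribed by [g0]. *)
Definition determined (S : B) (g : nat_trans (P S) (Q S)) (W : U B)
    (h : @hom B S (sval W)) : Prop :=
  forall N : H1 (sval W),
    g (pull H1 h N) ∘ theta P h N = theta Q h N ∘ fmap (pull H2 h) (gU N).

Lemma determined_over (S : B) (g : nat_trans (P S) (Q S)) (V W : U B)
    (k : @hom B S (sval V)) (b : @hom B (sval V) (sval W)) (h : @hom B S (sval W)) :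
  h = b ∘ k -> determined g k -> determined g h.
Proof.
move=> e gk N; apply: (iso_mono (iso_fmap (Q S) (conn_eq_iso e N))).
rewrite !composeA -(nt_natural g) -composeA !theta_conn_eq !composeA gk.
by rewrite -(composeA _ (conn_eq e _)) conn_eq_nat !composeA !fmapMr gU_theta.
Qed.

(** Every [A] is h^* h_* A through the counit, and on objects h^* N the condition fixes the
    value. *)
Lemma determined_uniq (S : B) (g g' : nat_trans (P S) (Q S)) (W : U B)
    (h : @hom B S (sval W)) :
  closed h -> determined g h -> determined g' h -> forall A, g A = g' A.
Proof.
move=> ch dg dg' A; have [hs [[adj] ff]] := localic_right_adj loc1 ch.
apply: (iso_epi (iso_fmap (P S) (adj_counit_iso adj ff A))).
rewrite !nt_natural; congr (_ ∘ _).
apply: (iso_epi (theta_iso P h (hs A))).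
by rewrite dg dg'.
Qed.

Lemma determined_closed (S : B) (W : U B) (h : @hom B S (sval W)) :
  closed h -> exists g : nat_trans (P S) (Q S), determined g h.
Proof.
move=> ch; have [hs [[adj] ff]] := localic_right_adj loc1 ch.
pose epsI := adj_counit_iso adj ff.
have [g gE] : exists g : forall A, hom (P S A) (Q S A), forall A,
    g A ∘ fmap (P S) (adj_counit adj A) ∘ theta P h (hs A)
    = fmap (Q S) (adj_counit adj A) ∘ theta Q h (hs A) ∘ fmap (pull H2 h) (gU (hs A)).
  exists (fun A => fmap (Q S) (adj_counit adj A) ∘ theta Q h (hs A)
    ∘ fmap (pull H2 h) (gU (hs A)) ∘ inv (theta_iso P h (hs A))
    ∘ fmap (P S) (inv (epsI A))) => A.
  by rewrite fmapMr invl fmap1 composec1 invlK.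
have gnat A A' (x : hom A A') : g A' ∘ fmap (P S) x = fmap (Q S) x ∘ g A.
  apply: (iso_epi (iso_comp (iso_fmap (P S) (epsI A)) (theta_iso P h (hs A)))).
  rewrite !composeA (comp32 (gE A)) fmapMr -adj_counit_nat fmapM !composeA.
  rewrite -(comp22 (theta_nat _ _ _)) gE fmapMr gU_nat fmapM !composeA.
  by rewrite (comp22 (theta_nat _ _ _)) -!fmapM adj_counit_nat.
exists (NatTrans gnat) => N /=.
have e1 : adj_counit adj (pull H1 h N) ∘ fmap (pull H1 h) (adj_unit adj N) = idc _.
  exact: adj_triangleL.
(* By the triangle identity [theta P h N] factors through the object h_* h^* N, on which [g] was
   defined. *)
have -> : theta P h N = fmap (P S) (adj_counit adj (pull H1 h N)) ∘ theta P h _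
    ∘ fmap (pull H2 h) (fmap (P _) (adj_unit adj N)).
  by rewrite -composeA theta_nat composeA -fmapM e1 fmap1 compose1c.
rewrite !composeA gE fmapMr gU_nat fmapM !composeA (comp22 (theta_nat _ _ _)).
by rewrite -fmapM e1 fmap1 compose1c.
Qed.

(** Take [g] from one closed embedding [s]. For any [h] the pair (s, h) is again closed; its
    transformation is determined at both [s] and [h], and by uniqueness at [s] it is [g]. *)
Lemma determined_ex (S : B) :
  exists g : nat_trans (P S) (Q S), forall (W : U B) (h : @hom B S (sval W)), determined g h.
Proof.
have [Y [s cs]] := closed_embedding S.
have [g dg] := determined_closed cs.
exists g => W h.
have [V [p [q pq]]] := U_product Y W.
have [sh [es eh]] := product_pair pq s h.
have csh : closed sh by apply: (@closed_cancel B _ _ _ sh p); rewrite es.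
have [g' dg'] := determined_closed csh.
have dh : determined g' h := determined_over (esym eh) dg'.
have ds : determined g' s := determined_over (esym es) dg'.
have E := determined_uniq cs dg ds.
by move=> N; rewrite E dh.
Qed.

Definition ext2 (S : B) : nat_trans (P S) (Q S) :=
  proj1_sig (constructive_indefinite_description _ (determined_ex S)).

Lemma ext2P (S : B) (W : U B) (h : @hom B S (sval W)) : determined (ext2 S) h.
Proof. by rewrite /ext2; case: constructive_indefinite_description => g; apply. Qed.

(** Reduce to A = s^* N. Since [s ∘ f] need not be closed, it matters that [ext2P] holds for all
    morphisms to objects of [U]. *)
Lemma ext2_theta (T S : B) (f : hom T S) (A : H1 S) :
  theta Q f A ∘ fmap (pull H2 f) (ext2 S A) = ext2 T (pull H1 f A) ∘ theta P f A.
Proof.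
have [Y [s cs]] := closed_embedding S.
have [ss [[adj] ff]] := localic_right_adj loc1 cs.
set eps := adj_counit adj A; have epsI : is_iso eps := adj_counit_iso adj ff A.
have i1 := iso_fmap (pull H2 f) (iso_comp (iso_fmap (P S) epsI) (theta_iso P s (ss A))).
have E : ext2 S A ∘ (fmap (P S) eps ∘ theta P s (ss A))
    = fmap (Q S) eps ∘ theta Q s (ss A) ∘ fmap (pull H2 s) (gU (ss A)).
  by rewrite composeA nt_natural -composeA ext2P composeA.
have e : s ∘ f = s ∘ f by [].
apply: (iso_epi (iso_comp i1 (conn_eq_iso e _))).
rewrite !composeA fmapMr E !fmapM !composeA.
rewrite !(comp22 (theta_nat _ _ _)) theta_nat nt_natural.
rewrite -(comp22 (conn_eq_nat e _)) -(comp23 (theta_conn_eq Q e (ss A))).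
by rewrite -(comp23 (theta_conn_eq P e (ss A))) (comp22 (nt_natural _ _)) (comp22 (ext2P _ _)).
Qed.

Definition mor2_ext : mor2 P Q := Mor2 ext2_theta.

(** Over [U] the identity is an admissible [h], and every [A] is isomorphic to its pullback along
    it. *)
Lemma restr_mor2_ext : restr_mor2 (@inU B) mor2_ext = g0.
Proof.
apply: mor2_eq => X A; rewrite /= -[g0 X A]/(gU A).
apply: (iso_epi (iso_fmap (P _) (iso_inv (id_pull_iso A)))).
rewrite nt_natural gU_nat; congr (_ ∘ _).
apply: (iso_epi (theta_iso P (idc (sval X)) A)).
by rewrite ext2P gU_theta.
Qed.

Lemma mor2_ext_uniq (g : mor2 P Q) : restr_mor2 (@inU B) g = g0 -> g = mor2_ext.
Proof.
move=> E; apply: mor2_eq => S; have [Y [s cs]] := closed_embedding S.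
apply: (determined_uniq cs) (ext2P s) => N.
by rewrite /gU -E -m2_theta.
Qed.

Lemma mor2_ext_iso : is_2iso g0 -> is_2iso mor2_ext.
Proof.
move=> i S A; have [Y [s cs]] := closed_embedding S.
have [ss [[adj] ff]] := localic_right_adj loc1 cs.
have epsI := adj_counit_iso adj ff A.
apply: (iso_cancel_r (iso_fmap (P S) epsI)); rewrite m2_nat.
apply: iso_comp (iso_fmap _ epsI) _.
apply: (iso_cancel_r (theta_iso P s (ss A))); rewrite ext2P.
apply: iso_comp; first exact: theta_iso.
exact: (iso_fmap (pull H2 s) (i Y (ss A))).
Qed.

End Uniqueness.

(** * Localicity of the extension *)

Section Detection.
Variables (B : base) (H : tri_fibered B).
Hypothesis loc : localic H.

Definition detected (S : B) : Prop := forall (X Y : H S) (a : hom X Y),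
  (forall (V : U B) (g : @hom B (sval V) S), is_iso (fmap (pull H g) a)) -> is_iso a.

(** On [Z] the tests are the composites [z ∘ g]; the open complement lies in [U] and is itself a
    test object. *)
Lemma detected_stratum (Z S : B) (z : hom Z S) (hz : closed z) :
  inU (compl hz) -> detected Z -> detected S.
Proof.
move=> hU dZ X Y a ha; apply: (localic_conservative loc (hz := hz)).
  apply: dZ => V g; have e : z ∘ g = z ∘ g by [].
  apply: (iso_cancel_r (conn_eq_iso e X)); rewrite -conn_eq_nat.
  exact: iso_comp (conn_eq_iso _ _) (ha V _).
exact: (ha (exist _ _ hU)).
Qed.

Lemma all_detected (S : B) : detected S.
Proof.
have [n [Zs [z [Z0 ZS hz]]]] := stratification S; rewrite -ZS.
suff main r : r <= n.+1 -> detected (Zs r) by apply: main.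
elim: r => [_ | r IH ltr].
  by rewrite Z0 => X Y a _; apply: zero_iso; apply: (localic_empty loc).
have [cz hU] := hz r ltr.
exact: detected_stratum hU (IH (ltnW ltr)).
Qed.

End Detection.

(** * Base change of the comparison p_# R -> R p_# *)

Section Comparisons.
Variable C : category.

(** Transposing removes [L'], leaving connections and a unit, which can be compared directly. *)
Lemma transpose_exchange (H : fibered C) (P S T PT : C)
    (p : hom P S) (f : hom T S) (f' : hom PT P) (p' : hom PT T) (e : p ∘ f' = f ∘ p')
    (L : functor (H P) (H S)) (adj : adjunction L (pull H p))
    (L' : functor (H PT) (H T)) (adj' : adjunction L' (pull H p')) (A : H P) :
  transpose adj' (exchange e adj adj' A)
  = conn_eq e (L A) ∘ inv (conn_eq_iso (erefl (p ∘ f')) (L A))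
    ∘ fmap (pull H f') (adj_unit adj A).
Proof.
have -> : exchange e adj adj' A = adj_counit adj' _ ∘ fmap L'
    (conn H p' f (L A) ∘ cast (congr1 (fun k => pull H k (L A)) e)
     ∘ ni_inv (conn H f' p) (L A) ∘ fmap (pull H f') (adj_unit adj A)).
  by rewrite fmapM.
rewrite transpose_counit conn_eqE; congr (_ ∘ _ ∘ _).
apply: (iso_epi (conn_eq_iso (erefl (p ∘ f')) (L A))); rewrite invl conn_eq_conn.
exact: (ni_invl (conn H f' p)).
Qed.

Lemma transpose_sharp (H1 H2 : fibered C) (R : fib_mor H1 H2) (P S : C) (p : hom P S)
    (L1 : functor (H1 P) (H1 S)) (adj1 : adjunction L1 (pull H1 p))
    (L2 : functor (H2 P) (H2 S)) (adj2 : adjunction L2 (pull H2 p)) (A : H1 P) :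
  transpose adj2 (sharp_comparison R adj1 adj2 A)
  = inv (theta_iso R p (L1 A)) ∘ fmap (R P) (adj_unit adj1 A).
Proof.
have -> : sharp_comparison R adj1 adj2 A = adj_counit adj2 _ ∘ fmap L2
    (ni_inv (theta R p) (L1 A) ∘ fmap (R P) (adj_unit adj1 A)).
  by rewrite fmapM.
rewrite transpose_counit; congr (_ ∘ _).
apply: (iso_mono (theta_iso R p (L1 A))); rewrite invr.
exact: (ni_invr (theta R p)).
Qed.

Lemma sharp_base_change (H1 H2 : fibered C) (R : fib_mor H1 H2) (P S T PT : C)
    (p : hom P S) (f : hom T S) (f' : hom PT P) (p' : hom PT T) (e : p ∘ f' = f ∘ p')
    (L1 : functor (H1 P) (H1 S)) (adj1 : adjunction L1 (pull H1 p))
    (L2 : functor (H2 P) (H2 S)) (adj2 : adjunction L2 (pull H2 p))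
    (L1' : functor (H1 PT) (H1 T)) (adj1' : adjunction L1' (pull H1 p'))
    (L2' : functor (H2 PT) (H2 T)) (adj2' : adjunction L2' (pull H2 p')) (A : H1 P) :
  theta R f (L1 A) ∘ fmap (pull H2 f) (sharp_comparison R adj1 adj2 A)
    ∘ exchange e adj2 adj2' (R P A)
  = fmap (R T) (exchange e adj1 adj1' A)
    ∘ sharp_comparison R adj1' adj2' (pull H1 f' A) ∘ fmap L2' (theta R f' A).
Proof.
apply: (transpose_inj (adj := adj2')).
(* Of the comparison over [S] only the equation for its transpose is kept. *)
have := transpose_sharp R adj1 adj2 A; rewrite transposeE.
move: (sharp_comparison R adj1 adj2 A) => cp Ecp.
rewrite -composeA -[in RHS]composeA -fmap_transpose composeA -!transpose_comp.
rewrite -(fmap_transpose _ (fmap (pull H2 f) _)) transpose_exchange.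
rewrite -(fmap_transpose _ (fmap (R T) _)) transpose_sharp.
apply: (iso_mono (theta_iso R p' (pull H1 f (L1 A)))).
rewrite !composeA !theta_nat !invrK.
have <- : fmap (R PT) (transpose adj1' (exchange e adj1 adj1' A))
    = fmap (R PT) (fmap (pull H1 p') (exchange e adj1 adj1' A))
      ∘ fmap (R PT) (adj_unit adj1' (pull H1 f' A)).
  by rewrite transposeE fmapM.
rewrite transpose_exchange !fmapM.
rewrite -(comp22 (theta_nat _ _ _)) -(comp22 (conn_eq_nat e cp)) -theta_conn_eq.
set e0 := erefl (p ∘ f').
have K1 : fmap (pull H2 (p ∘ f')) cp ∘ inv (conn_eq_iso e0 (L2 (R P A)))
    = inv (conn_eq_iso e0 _) ∘ fmap (pull H2 f') (fmap (pull H2 p) cp).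
  apply: (iso_epi (conn_eq_iso e0 (L2 (R P A)))).
  apply: (iso_mono (conn_eq_iso e0 (R S (L1 A)))).
  by rewrite invlK !composeA invr compose1c conn_eq_nat.
(* The cocycle condition of [theta] for [p ∘ f'], with the connections and [theta R p] moved
   across. *)
have K2 : theta R (p ∘ f') (L1 A) ∘ inv (conn_eq_iso e0 (R S (L1 A)))
      ∘ fmap (pull H2 f') (inv (theta_iso R p (L1 A)))
    = fmap (R PT) (inv (conn_eq_iso e0 (L1 A))) ∘ theta R f' (pull H1 p (L1 A)).
  apply: (iso_mono (iso_fmap (R PT) (conn_eq_iso e0 (L1 A)))).
  rewrite !composeA -fmapM invr fmap1 compose1c theta_conn_eq invrK fmapMr invr.
  by rewrite fmap1 composec1.
by rewrite (comp22 K1) fmapMr Ecp fmapM !composeA -(comp32 K2).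
Qed.

End Comparisons.

(** Invertibility is tested on f : V -> S with [V] in [U]. The base change of [p] along [f] lies in
    [U], where [locR] applies, and [sharp_base_change] relates the two comparisons. *)
Lemma extension_localic (B : base) (H1 H2 : tri_fibered B)
    (loc1 : localic H1) (loc2 : localic H2) (Rt : tri_mor H1 H2) :
  localic_mor (@smoothU B) (restr_mor (@inU B) Rt) -> localic_mor (@smooth B) Rt.
Proof.
move=> locR P S p L1 adj1 L2 adj2 A sp; apply: (all_detected loc2) => V f.
have [PT [f' [p' cart]]] := smooth_pullback_ex f sp.
have sp' := smooth_pullback sp cart.
have [L1' [adj1']] := localic_left_adj loc1 sp'.
have [L2' [adj2']] := localic_left_adj loc2 sp'.
pose W : U B := exist _ PT (inU_smooth sp' (svalP V)).
have i1 := localic_base_change loc1 adj1 adj1' cart A sp.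
have i2 := localic_base_change loc2 adj2 adj2' cart (Rt P A) sp.
have i3 : is_iso (sharp_comparison Rt adj1' adj2' (pull H1 f' A)).
  exact: (locR W V p' L1' adj1' L2' adj2' (pull H1 f' A) sp').
apply: (iso_cancel_l (theta_iso Rt f (L1 A))); apply: (iso_cancel_r i2).
rewrite (sharp_base_change Rt (proj1 cart) adj1 adj2 adj1' adj2').
apply: iso_comp (iso_fmap _ (theta_iso _ _ _)).
exact: iso_comp (iso_fmap _ i1) i3.
Qed.

Theorem theorem2p3 (B : base) (H1 H2 : tri_fibered B)
    (localic1 : localic H1) (localic2 : localic H2)
    (R : tri_mor (restr_tri (@inU B) H1) (restr_tri (@inU B) H2))
    (localicR : localic_mor (@smoothU B) R) :
  (exists Rt : tri_mor H1 H2, restr_mor (@inU B) Rt = R)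
  /\ (forall (Rt Rt' : tri_mor H1 H2)
        (e : restr_mor (@inU B) Rt = R) (e' : restr_mor (@inU B) Rt' = R),
        exists! gamma : mor2 Rt Rt',
          is_2iso gamma
          /\ restr_mor2 (@inU B) gamma = mor2_of_eq (eq_trans e (eq_sym e')))
  /\ (forall Rt : tri_mor H1 H2,
        restr_mor (@inU B) Rt = R -> localic_mor (@smooth B) Rt).
Proof.
split; [exact: extension_exists | split=> [Rt Rt' e e' | Rt e]].
  pose g0 := mor2_of_eq (eq_trans e (eq_sym e')).
  exists (mor2_ext localic1 g0); split.
    have i0 : is_2iso g0 by apply: mor2_of_eq_iso.
    split; first apply: (mor2_ext_iso localic1 i0).
    exact: restr_mor2_ext.
  by move=> g [_ eg]; apply/esym/mor2_ext_uniq.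
by apply: extension_localic => //; rewrite e.
Qed.
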